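(* Let $m\ge1$ and $0<\alpha<\pi$. For every compact set $Q\subset\Gamma$ with $|Q|=2\alpha$, $$E_m(Q)\ge2\sin^m\frac\alpha2,$$ with equality if and only if $Q$ is an arc of $\Gamma$ (of length $2\alpha$). Consequently $E_m(2\alpha)=2\sin^m\frac\alpha2$.
   Context: $\Gamma$ is the unit circle of $\mathbb{C}$ with arc-length measure $|\cdot|$; $\mathfrak{P}_m(\Gamma)$ is the set of monic algebraic polynomials of degree $m$ all of whose zeros lie on $\Gamma$. For a compact set $Q\subset\Gamma$, $E_m(Q)=\inf\{\max_{z\in Q}|P(z)|:P\in\mathfrak{P}_m(\Gamma)\}$, and $E_m(2\alpha)=\inf\{E_m(Q):Q\subset\Gamma\text{ compact},|Q|=2\alpha\}$. *)

(* Defs.v *)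
From Stdlib Require Import Reals Lra List.
Import ListNotations.
Open Scope R_scope.

Definition pt := (R * R)%type.

Definition cdist (z w : pt) : R :=
  sqrt ((fst z - fst w) ^ 2 + (snd z - snd w) ^ 2).

Definition on_Gamma (z : pt) : Prop := fst z ^ 2 + snd z ^ 2 = 1.

Definition cexp (t : R) : pt := (cos t, sin t).

Definition pt_cv (u : nat -> pt) (p : pt) : Prop :=
  Un_cv (fun n => fst (u n)) (fst p) /\ Un_cv (fun n => snd (u n)) (snd p).

Definition closed_set (Q : pt -> Prop) : Prop :=
  forall (u : nat -> pt) (p : pt), (forall n, Q (u n)) -> pt_cv u p -> Q p.

Definition bounded_set (Q : pt -> Prop) : Prop :=
  exists M, forall z, Q z -> cdist z (0, 0) <= M.

Definition compact_set (Q : pt -> Prop) : Prop := closed_set Q /\ bounded_set Q.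

Definition is_glb (S : R -> Prop) (g : R) : Prop :=
  (forall x, S x -> g <= x) /\ (forall b, (forall x, S x -> b <= x) -> b <= g).

(* Lebesgue measure of a compact subset K of R: infimum of total lengths of
   finite covers by nonempty open intervals (equal to the Lebesgue measure
   for compact K). *)
Fixpoint cover_length (c : list (R * R)) : R :=
  match c with
  | [] => 0
  | (a, b) :: c' => (b - a) + cover_length c'
  end.

Definition is_cover (K : R -> Prop) (c : list (R * R)) : Prop :=
  (forall ab, In ab c -> fst ab < snd ab) /\
  (forall x, K x -> exists ab, In ab c /\ fst ab < x < snd ab).

Definition lebesgue_measure_compact (K : R -> Prop) (mu : R) : Prop :=
  is_glb (fun l => exists c, is_cover K c /\ l = cover_length c) mu.

Definition arc_measure (Q : pt -> Prop) (mu : R) : Prop :=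
  lebesgue_measure_compact (fun t => 0 <= t <= 2 * PI /\ Q (cexp t)) mu.

(* |P(z)| for the monic polynomial P(z) = prod_k (z - w_k) with zero list ws *)
Fixpoint poly_abs (ws : list pt) (z : pt) : R :=
  match ws with
  | [] => 1
  | w :: ws' => cdist z w * poly_abs ws' z
  end.

(* ws encodes an element of P_m(Gamma): m zeros (with multiplicity), all on Gamma *)
Definition in_Pm (m : nat) (ws : list pt) : Prop :=
  length ws = m /\ forall w, In w ws -> on_Gamma w.

Definition is_sup_norm (Q : pt -> Prop) (ws : list pt) (M : R) : Prop :=
  is_lub (fun v => exists z, Q z /\ v = poly_abs ws z) M.

Definition is_Em (m : nat) (Q : pt -> Prop) (e : R) : Prop :=
  is_glb (fun v => exists ws, in_Pm m ws /\ is_sup_norm Q ws v) e.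

Definition admissible (Q : pt -> Prop) (l : R) : Prop :=
  compact_set Q /\ (forall z, Q z -> on_Gamma z) /\ arc_measure Q l.

Definition is_Em_len (m : nat) (l : R) (e : R) : Prop :=
  is_glb (fun v => exists Q, admissible Q l /\ is_Em m Q v) e.

Definition is_arc (Q : pt -> Prop) (l : R) : Prop :=
  exists t0, forall z, Q z <-> exists t, t0 <= t <= t0 + l /\ z = cexp t.

(* Main.v *)
(** Write [s = sin (alpha / 2)] and let [E] be the set of angles where [|P| <= M].  It is a finite union of closed
    arcs; suppose that there are [n] of them, of total length [2 alpha].

    The Blaschke product [phi] of degree [n] with [phi 0 = 0] that maps each arc of [E] onto one fixed arc of length
    [2 alpha] has denominator [b - a], where [a] and [b] are the monic polynomials whose roots are the left and right
    endpoints of the arcs.  Pulling back [k] Chebyshev-like nodes of the fixed arc gives [n k] points of [E], and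
    Lagrange interpolation of [(b - a)^k p] at these points yields [|p 0| s^(k-1) <= K max_E |p|] for every polynomial
    [p] of degree less than [k], with [K] independent of [k].

    On the circle, [P z] is [2^m z^(m/2)] times a real function up to a unimodular constant, so the polynomials
    [Y_N = y1^N + y2^N], where [y1 + y2 = 2 P] and [y1 y2 = M^2 P(0) z^m], satisfy [|Y_N| <= 2 M^N] on [E] although
    [|Y_N 0| = 2^N]; this is the Chebyshev polynomial [T_N] composed with [P].  Letting [N] grow gives
    [2 s^m <= M].

    If [n >= 2], then [b - a] has a root (possibly at infinity), and [(b - a)^J] can be replaced by a polynomial of the
    same degree, no larger on [E] and strictly larger at [0]: reflect the root when it lies inside the circle, and
    otherwise multiply by a polynomial in the corresponding Moebius map that peaks, like a Poisson kernel, at a gap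
    of [E].  So the inequality is strict unless [E] is an arc. *)

Require Import Defs.
From Stdlib Require Import Reals Lra Lia List Classical ClassicalChoice.
From mathcomp Require all_boot all_order all_algebra complex Rstruct ring lra.
Import ListNotations.
Open Scope R_scope.

(** Multiplying by [(b - a)^k] is what reduces several arcs to one. If [z] lies over the node
    [e tau], the distances from [z] to the [n] points over [e tau'] multiply to [|e tau - e tau'|]
    times [|(b - a)(z)| / (2 sin alpha)]. The weights therefore cancel in the Lagrange formula up to
    one factor, and the node product of a single arc remains; moreover [|(b - a)(0)| = 2 sin alpha],
    whatever the position of the arcs.

    The constant [K] disappears only in the limit of large degree, so strictness cannot be read off
    from one interpolation: the gain must be exponential, a factor [rho > 1] for every [J] powers of
    [b - a]. Since the leading terms of [a] and [b] cancel, [b - a] has degree at most [n - 1]. For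
    one arc it is constant and no degree is left for an improvement, in accordance with the equality
    case.

    Passing from [Q] to arcs needs care at the level [|P| = M]: an isolated level point would be a
    degenerate arc. Midpoint log-concavity of [|P|] between its zeros excludes this. *)

Module CircleAlgebra.
Import all_boot all_order all_algebra.
Import complex Rstruct ring lra.
Import Order.TTheory GRing.Theory Num.Theory Normc.
Set Implicit Arguments.
Unset Strict Implicit.
Unset Printing Implicit Defensive.
Local Open Scope ring_scope.
Local Open Scope complex_scope.
Notation R := Rdefinitions.R.
Notation C := (complex R).
#[local] Notation Re := (@complex.Re R).
#[local] Notation Im := (@complex.Im R).
#[local] Arguments cos _%_R.
#[local] Arguments sin _%_R.
#[local] Arguments asin _%_R.
Bind Scope ring_scope with Rdefinitions.R.

(** * Points of the unit circle and Lagrange interpolation at the centre *)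

Definition e (t : R) : C := cos t +i* sin t.

Lemma eD x y : e (x + y) = e x * e y.
Proof.
rewrite /e cosD sinD; apply/eqP; rewrite eq_complex /=.
by apply/andP; split; apply/eqP; ring.
Qed.

Lemma e0 : e 0 = 1.
Proof. by rewrite /e cos_0 sin_0. Qed.

Lemma normc_ge0 (z : C) : 0 <= normc z.
Proof. by case: z => x y /=; exact: sqrtr_ge0. Qed.

Lemma normc_eq0 (z : C) : (normc z == 0) = (z == 0).
Proof. by apply/eqP/eqP => [/eq0_normc|->] //; rewrite normc0. Qed.

Lemma normcX (z : C) n : normc (z ^+ n) = normc z ^+ n.
Proof. by elim: n => [|n IH]; rewrite ?expr0 ?normc1 // !exprS normcM IH. Qed.

Lemma normc_prod (I : finType) (P : pred I) (F : I -> C) :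
  normc (\prod_(i | P i) F i) = \prod_(i | P i) normc (F i).
Proof.
by apply: (big_morph (fun z : C => normc z)); [exact: normcM | exact: normc1].
Qed.

Lemma normc_sum (I : finType) (F : I -> C) :
  normc (\sum_i F i) <= \sum_i normc (F i).
Proof.
elim/big_rec2: _ => [|i x y _ IH]; first by rewrite normc0.
by apply: le_trans (le_normcD _ _) _; rewrite lerD2l.
Qed.

Lemma normcr (x : R) : normc x%:C = `|x|.
Proof. by rewrite /= expr0n /= addr0 sqrtr_sqr. Qed.

Lemma normcB (x y : C) : normc (x - y) = normc (y - x).
Proof. by rewrite -normcN opprB. Qed.

Lemma normci : normc ('i : C) = 1.
Proof. by rewrite /= expr0n /= add0r expr1n sqrtr1. Qed.

(** Evaluation at [0] makes every numerator [|0 - z j|] equal to [1], so only the mutual distances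
    of the nodes remain. *)
Lemma lagrange_bound (I : finType) (z : I -> C) (A : {poly C}) :
  injective z -> (forall i, normc (z i) = 1) -> (size A <= #|I|)%N ->
  normc A.[0] <= \sum_i normc A.[z i] / \prod_(j | j != i) normc (z i - z j).
Proof.
move=> zinj z1 szA.
pose L i : {poly C} := \prod_(j | j != i) ((z i - z j)^-1 *: ('X - (z j)%:P)).
have LE i x : (L i).[x] = \prod_(j | j != i) ((z i - z j)^-1 * (x - z j)).
  by rewrite horner_prod; apply: eq_bigr => j _; rewrite hornerZ hornerXsubC.
have szL i : (size (L i) <= #|I|)%N.
  have le2 j : (size ((z i - z j)^-1 *: ('X - (z j)%:P)) <= 2)%N.
    by apply: leq_trans (size_scale_leq _ _) _; rewrite size_XsubC.
  apply: leq_trans (size_poly_prod_leq _ _) _.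
  rewrite leq_subLR (_ : #|_| + #|I| = (\sum_(j | j != i) 2).+1)%N.
    by rewrite ltnS; apply: leq_sum => j _; exact: le2.
  rewrite sum_nat_const muln2 -addnn -addnS; congr (_ + _)%N.
  rewrite (eq_card (B := predC1 i)) // cardC1 prednK //.
  by apply/card_gt0P; exists i.
have AE : A = \sum_i (A.[z i]) *: L i.
  apply/eqP; rewrite -subr_eq0; apply/eqP.
  set D := A - _.
  apply: (@roots_geq_poly_eq0 _ D [seq z i | i <- enum I]).
  - apply/allP => _ /mapP[i _ ->]; rewrite /root hornerD hornerN horner_sum.
    rewrite (bigD1 i) //= hornerZ LE big1 ?mulr1; last first.
      by move=> j nij; rewrite mulVf // subr_eq0; apply: contra nij => /eqP/zinj->.
    rewrite big1 ?addr0 ?subrr // => j nji.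
    by rewrite hornerZ LE (bigD1 i) 1?eq_sym //= subrr mulr0 mul0r mulr0.
  - by rewrite map_inj_uniq // enum_uniq.
  - rewrite size_map -cardE; apply: leq_trans (size_polyD _ _) _.
    rewrite geq_max szA size_polyN /=.
    apply: (leq_trans (size_sum _ _ _)); apply/bigmax_leqP => i _.
    exact: leq_trans (size_scale_leq _ _) _.
rewrite {1}AE horner_sum; apply: le_trans (normc_sum _) _.
apply: ler_sum => i _; rewrite hornerZ LE normcM normc_prod.
rewrite ler_wpM2l ?normc_ge0 // -prodfV.
apply: ler_prod => j _; rewrite normc_ge0 /= normcM normcV sub0r normcN z1.
by rewrite mulr1.
Qed.

(** * Chebyshev nodes on an arc *)

(** The pair [(T_k, U_(k-1))] of Chebyshev polynomials of both kinds, advanced together by the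
    addition formulas for [cos ((k + 1) w)] and [sin ((k + 1) w)]. *)
Fixpoint cheb (k : nat) : {poly R} * {poly R} :=
  if k is k'.+1 then
    ('X * (cheb k').1 - (1 - 'X ^+ 2) * (cheb k').2, 'X * (cheb k').2 + (cheb k').1)
  else (1, 0).

Lemma cheb_cos k (w : R) :
  (cheb k).1.[cos w] = cos (k%:R * w) /\ (cheb k).2.[cos w] * sin w = sin (k%:R * w).
Proof.
elim: k => [|k [IH1 IH2]].
  by rewrite !mul0r cos_0 sin_0 /= !hornerE ?mul0r.
rewrite -addn1 natrD mulrDl mul1r cosD sinD -IH1 -IH2 addn1 /= !hornerE.
have s2 : sin w ^+ 2 = 1 - cos w ^+ 2.
  by rewrite !expr2; exact: sin2.
by split; ring: s2.
Qed.

(** Differentiating the recursion brings in [(1 - X^2) U'], so the formula for [T'] becomes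
    inductive only together with the second identity. *)
Lemma cheb_deriv k :
  (cheb k).1^`() = k%:R *: (cheb k).2 /\
  (1 - 'X ^+ 2) * (cheb k).2^`() = 'X * (cheb k).2 - k%:R *: (cheb k).1.
Proof.
elim: k => [|k [IH1 IH2]]; first by rewrite /= !derivE scale0r !mulr0 scale0r subr0.
rewrite -!mul_polyC in IH1 IH2 *.
rewrite /= !derivE IH1 -[k.+1]addn1 natrD polyCD.
move: (cheb k).1 (cheb k).2 (cheb k).2^`() IH2 => T U U' IH2.
split.
  transitivity (T + k%:R%:P * 'X * U - ((1 - 'X ^+ 2) * U' - 'X *+ 2 * U)); first by ring.
  by rewrite IH2; ring.
transitivity ((1 - 'X ^+ 2) * U + 'X * ((1 - 'X ^+ 2) * U') + (1 - 'X ^+ 2) * k%:R%:P * U).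
  by ring.
by rewrite IH2; ring.
Qed.

Lemma cheb_coef k :
  [/\ (size (cheb k.+1).1 <= k.+2)%N, (size (cheb k.+1).2 <= k.+1)%N,
      (cheb k.+1).1`_k.+1 = 2 ^+ k & (cheb k.+1).2`_k = 2 ^+ k].
Proof.
elim: k => [|k [s1 s2 c1 c2]].
  rewrite /= !mulr0 subr0 add0r mulr1 size_polyX size_poly1 coefX coef1 !eqxx expr0.
  by [].
have E1 : (cheb k.+2).1 = 'X * (cheb k.+1).1 - (1 - 'X ^+ 2) * (cheb k.+1).2 by [].
have E2 : (cheb k.+2).2 = 'X * (cheb k.+1).2 + (cheb k.+1).1 by [].
move: s1 s2 c1 c2; rewrite E1 E2.
move: (cheb k.+1).1 (cheb k.+1).2 => T U s1 s2 c1 c2.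
have XT (p : {poly R}) n : (size p <= n)%N -> (size ('X * p)%R <= n.+1)%N.
  by move=> h; rewrite mulrC; apply: leq_trans (size_polyMleq _ _) _; rewrite size_polyX addn2.
rewrite mulrBl mul1r opprB expr2 -mulrA; split.
- apply: leq_trans (size_polyD _ _) _; rewrite geq_max (XT _ _ s1) /=.
  apply: leq_trans (size_polyD _ _) _; rewrite geq_max size_polyN (XT _ _ (XT _ _ s2)) /=.
  by apply: leq_trans s2 _; rewrite ltnW.
- by apply: leq_trans (size_polyD _ _) _; rewrite geq_max (XT _ _ s2).
- rewrite !coefD !coefXM /= coefN ?coefXM /= c1 c2.
  by rewrite (nth_default _ (leq_trans s2 _)) // subr0 exprS; ring.
- by rewrite coefD coefXM /= c1 c2 exprS; ring.
Qed.

Definition cnode (k : nat) (i : 'I_k) : R := (i.*2.+1%:R * PI / k.*2%:R).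

Lemma cnode_bound k (i : 'I_k) : 0 < cnode i < PI.
Proof.
have k0 : (0 : R) < k.*2%:R by rewrite ltr0n double_gt0 (leq_ltn_trans _ (ltn_ord i)).
have pi0 : 0 < PI by apply/RltP; exact: PI_RGT_0.
rewrite /cnode; apply/andP; split; first by rewrite divr_gt0 // mulr_gt0 // ltr0n.
rewrite ltr_pdivrMr // [ltRHS]mulrC ltr_pM2r // ltr_nat.
by rewrite -doubleS leq_double.
Qed.

Lemma cnode_inj k : injective (fun i : 'I_k => cos (cnode i)).
Proof.
move=> i j E; have [/andP[/RltP i0 /RltP i1] /andP[/RltP j0 /RltP j1]] := (cnode_bound i, cnode_bound j).
have pi0 : PI != 0 by apply/eqP; exact: PI_neq0.
have k0 : (k.*2%:R : R) != 0 by rewrite pnatr_eq0 double_eq0 -lt0n (leq_ltn_trans _ (ltn_ord i)).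
have : cnode i = cnode j.
  by apply: cos_inj => //; split; apply/RleP; apply: ltW; apply/RltP.
rewrite /cnode => /(mulIf (invr_neq0 k0))/(mulIf pi0)/eqP.
by rewrite eqr_nat eqSS -!muln2 eqn_pmul2r // => /eqP/val_inj.
Qed.

Lemma cnode_trig k (i : 'I_k) : cos (k%:R * cnode i) = 0 /\ `|sin (k%:R * cnode i)| = 1.
Proof.
have k0 : (k%:R : R) != 0 by rewrite pnatr_eq0 -lt0n (leq_ltn_trans _ (ltn_ord i)).
have -> : k%:R * cnode i = PI / 2 + i%:R * PI.
  rewrite /cnode -[i.*2.+1]addn1 natrD -!muln2 !natrM; field.
  by rewrite k0.
have [cn sn] : cos (i%:R * PI) = (-1) ^+ i /\ sin (i%:R * PI) = 0.
  elim: (i : nat) => [|n [IHc IHs]]; first by rewrite !mul0r cos_0 sin_0.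
  rewrite -addn1 natrD mulrDl mul1r cosD sinD IHc IHs cos_PI sin_PI exprD expr1.
  by split; rewrite ?mul0r ?mulr0 ?subr0 ?addr0.
rewrite cosD sinD cn sn cos_PI2 sin_PI2; split; first by rewrite mul0r mulr0 subr0.
by rewrite mulr0 addr0 mul1r normrX normrN1 expr1n.
Qed.

Lemma cheb_factor k : (cheb k.+1).1 = 2 ^+ k *: \prod_(i < k.+1) ('X - (cos (cnode i))%:P).
Proof.
have [s1 _ c1 _] := cheb_coef k.
have p2 : (2 : R) ^+ k != 0 by rewrite expf_neq0 ?pnatr_eq0.
have sz : size (cheb k.+1).1 = k.+2.
  apply/eqP; rewrite eqn_leq s1 ltnNge; apply: contraNN p2 => h.
  by rewrite -c1 nth_default.
rewrite [LHS](@all_roots_prod_XsubC _ _ [seq cos (cnode i) | i <- enum 'I_k.+1]).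
- by rewrite lead_coefE sz c1 big_image.
- by rewrite size_map size_enum_ord sz.
- apply/allP => _ /mapP[i _ ->]; rewrite /root (cheb_cos _ _).1.
  by rewrite (cnode_trig i).1.
- by rewrite uniq_rootsE map_inj_uniq ?enum_uniq //; exact: cnode_inj.
Qed.

Lemma cheb_prod_le k (w : R) :
  \prod_(i < k.+1) `|cos w - cos (cnode i)| * 2 ^+ k <= 1.
Proof.
have := (cheb_cos k.+1 w).1; rewrite cheb_factor hornerZ horner_prod.
under eq_bigr => i _ do rewrite hornerXsubC.
move=> /(congr1 (fun x => `|x|)); rewrite normrM normr_prod normrX normr_nat mulrC => ->.
by rewrite -RabsE; apply/RleP; apply: Rabs_le; exact: COS_bound.
Qed.

(** The right-hand side is [|T'|] at a zero of [T = T_(k+1)]. There [|T'| = (k + 1) |U_k|], and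
    [|U_k| |sin (cnode i)| = 1] forces [|U_k| >= 1]. *)
Lemma cheb_prod_deriv k (i : 'I_k.+1) :
  k.+1%:R <= 2 ^+ k * \prod_(j < k.+1 | j != i) `|cos (cnode i) - cos (cnode j)|.
Proof.
have E : (cheb k.+1).1^`().[cos (cnode i)] =
    2 ^+ k * \prod_(j < k.+1 | j != i) (cos (cnode i) - cos (cnode j)).
  rewrite cheb_factor derivZ hornerZ; congr (_ * _).
  rewrite (bigD1 i) //= derivM derivXsubC mul1r hornerD hornerM hornerXsubC.
  rewrite subrr mul0r addr0 horner_prod.
  by apply: eq_bigr => j _; rewrite hornerXsubC.
move: E; rewrite (cheb_deriv _).1 hornerZ => /(congr1 (fun x => `|x|)).
rewrite !normrM normr_nat normrX normr_nat normr_prod => <-.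
rewrite -[leLHS]mulr1 ler_wpM2l ?ler0n //.
have := (cheb_cos k.+1 (cnode i)).2 => /(congr1 (fun x => `|x|)).
rewrite (cnode_trig i).2 normrM => <-; rewrite -[leRHS]mulr1 ler_wpM2l //.
by rewrite -RabsE; apply/RleP; apply: Rabs_le; exact: SIN_bound.
Qed.

Lemma cosN (x : R) : cos (- x) = cos x.
Proof. exact: cos_neg. Qed.

Lemma sinN (x : R) : sin (- x) = - sin x.
Proof. exact: sin_neg. Qed.

Lemma eB (t u : R) : e t - e u = (2 * sin ((t - u) / 2))%:C * 'i * e ((t + u) / 2).
Proof.
set p := (t + u) / 2; set q := (t - u) / 2.
have [-> ->] : t = p + q /\ u = p - q by rewrite /p /q; split; field.
move: p q => p q.
rewrite /e !sinD !cosD cosN sinN.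
by apply/eqP; rewrite eq_complex /=; apply/andP; split; apply/eqP; ring.
Qed.

Lemma normc_e t : normc (e t) = 1.
Proof.
rewrite /= (_ : _ + _ = 1) ?sqrtr1 // !expr2 addrC.
exact: sin2_cos2.
Qed.

Lemma normc_eB t u : normc (e t - e u) = 2 * `|sin ((t - u) / 2)|.
Proof. by rewrite eB !normcM normc_e normci normcr normrM normr_nat !mulr1. Qed.

(** Pullbacks of the Chebyshev zeros under [t -> sin (t / 2) / sin (alpha / 2)], which maps
    [[- alpha, alpha]] increasingly onto [[-1, 1]]. *)
Definition anode (alpha : R) k (i : 'I_k) : R := 2 * asin (sin (alpha / 2) * cos (cnode i)).

Lemma sin_half_gt0 (alpha : R) : 0 < alpha < PI -> 0 < sin (alpha / 2).
Proof.
move=> /andP[a0 api].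
apply/RltP; apply: sin_gt_0; apply/RltP; first by rewrite divr_gt0.
by change (alpha / 2 < PI); lra.
Qed.

Lemma cos_half_gt0 (alpha : R) : 0 < alpha < PI -> 0 < cos (alpha / 2).
Proof.
move=> /andP[a0 api].
apply/RltP; apply: cos_gt_0; apply/RltP; first by change (- (PI / 2) < alpha / 2); lra.
by change (alpha / 2 < PI / 2); lra.
Qed.

Lemma sin_cos1 x : sin x ^+ 2 + cos x ^+ 2 = 1.
Proof. by rewrite !expr2; exact: sin2_cos2. Qed.

Lemma sin_half_lt1 (alpha : R) : 0 < alpha < PI -> sin (alpha / 2) < 1.
Proof. by move=> /cos_half_gt0; have := sin_cos1 (alpha / 2); nra. Qed.

Lemma anode_sin (alpha : R) k (i : 'I_k) : 0 < alpha < PI ->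
  sin (anode alpha i / 2) = sin (alpha / 2) * cos (cnode i).
Proof.
move=> ha; set s := sin (alpha / 2).
rewrite /anode (_ : 2 * _ / 2 = asin (s * cos (cnode i))); last by field.
have [xl xu] : -1 <= cos (cnode i) /\ cos (cnode i) <= 1.
  by have [/RleP h /RleP h'] := COS_bound (cnode i).
have s0 : 0 < s := sin_half_gt0 ha; have s1 : s < 1 := sin_half_lt1 ha.
have /andP[h1 h2] : -1 <= s * cos (cnode i) <= 1.
  move: s s0 s1 (cos (cnode i)) xl xu => {}s s0 s1 x xl xu.
  by apply/andP; split; nra.
by apply: sin_asin; split; apply/RleP.
Qed.

Lemma cos_anode_ge (alpha : R) k (i : 'I_k) : 0 < alpha < PI ->
  cos (alpha / 2) <= cos (anode alpha i / 2).
Proof.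
move=> ha; set c := cos (alpha / 2); set s := sin (alpha / 2).
have s0 : 0 < s := sin_half_gt0 ha; have s1 : s < 1 := sin_half_lt1 ha; have c0 : 0 < cos (alpha / 2) := cos_half_gt0 ha.
have cn0 : 0 <= cos (anode alpha i / 2).
  have -> : anode alpha i / 2 = asin (s * cos (cnode i)) by rewrite /anode; field.
  have [h1 h2] := asin_bound (s * cos (cnode i)).
  by apply/RleP; apply: cos_ge_0 => //; apply: Rle_trans h1; right; field.
have h1 := sin_cos1 (anode alpha i / 2); have h2 := sin_cos1 (alpha / 2).
have h3 := sin_cos1 (cnode i).
rewrite -(ler_pXn2r (n := 2)) ?nnegrE // ?(ltW c0) //.
move: h1; rewrite anode_sin // -/s => h1.
have : cos (anode alpha i / 2) ^+ 2 = c ^+ 2 + s ^+ 2 * sin (cnode i) ^+ 2.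
  by move: h1 h2 h3; rewrite -/s -/c; nra.
by move=> ->; rewrite lerDl mulr_ge0 ?sqr_ge0.
Qed.

Lemma anode_bound (alpha : R) k (i : 'I_k) : 0 < alpha < PI ->
  - alpha < anode alpha i < alpha.
Proof.
move=> ha; set s := sin (alpha / 2); have [a0 api] := andP ha.
have s0 : 0 < s := sin_half_gt0 ha; have s1 : s < 1 := sin_half_lt1 ha; have c0 : 0 < cos (alpha / 2) := cos_half_gt0 ha.
have hs : `|sin (anode alpha i / 2)| < s.
  rewrite anode_sin // -/s normrM gtr0_norm // -[ltRHS]mulr1 ltr_pM2l //.
  rewrite -(ltr_pXn2r (n := 2)) ?nnegrE ?normr_ge0 // expr1n real_normK ?num_real //.
  have [/andP[/RltP i0 /RltP i1]] := cnode_bound i.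
  have /RltP := sin_gt_0 _ i0 i1.
  have := sin_cos1 (cnode i); rewrite -[IZR 0]/(0 : R).
  by move=> h1 h2; nra.
have E : anode alpha i / 2 = asin (s * cos (cnode i)) by rewrite /anode; field.
have [b1 b2] := asin_bound (s * cos (cnode i)); move: b1 b2; rewrite -E => /RleP b1 /RleP b2.
have [a1 a2] : - (PI / 2) <= alpha / 2 /\ alpha / 2 <= PI / 2 by split; lra.
move: hs; rewrite ltr_norml => /andP[h1 h2].
have l1 : anode alpha i / 2 < alpha / 2.
  by apply/RltP; apply: sin_increasing_0; first [by apply/RltP | by apply/RleP].
have l2 : - (alpha / 2) < anode alpha i / 2.
  have [a3 a4] : - (PI / 2) <= - (alpha / 2) /\ - (alpha / 2) <= PI / 2 by split; lra.
  apply/RltP; apply: sin_increasing_0; try by apply/RleP.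
  by apply/RltP; rewrite sinN.
by apply/andP; split; lra.
Qed.

Lemma cnode_rev k (j : 'I_k) : cnode (rev_ord j) = PI - cnode j.
Proof.
have k0 : (k%:R : R) != 0 by rewrite pnatr_eq0 -lt0n (leq_ltn_trans _ (ltn_ord j)).
rewrite /cnode /= -!muln2 -[(_ * 2).+1]addn1 -[(j * 2).+1]addn1 !natrD !natrM.
by rewrite natrB ?ltn_ord // -addn1 natrD; field.
Qed.

Lemma anode_rev alpha k (j : 'I_k) : anode alpha (rev_ord j) = - anode alpha j.
Proof.
rewrite /anode cnode_rev cosD cosN sinN cos_PI sin_PI mul0r subr0 mulN1r mulrN.
by rewrite (asin_opp _ : asin (- _) = - asin _) mulrN.
Qed.

(* Pairing the node [j] with its mirror image [rev_ord j] turns the chords into differences of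
   Chebyshev points; the parity keeps [i] and its mirror image apart. *)
Lemma anode_prod (alpha : R) k (i : 'I_k) : 0 < alpha < PI -> ~~ odd k ->
  \prod_(j < k | j != i) (2 * `|sin ((anode alpha i - anode alpha j) / 2)|) =
  cos (anode alpha i / 2) * \prod_(j < k | j != i) (2 * sin (alpha / 2) * `|cos (cnode i) - cos (cnode j)|).
Proof.
move=> ha evk; set s := sin (alpha / 2); have s0 : 0 < s := sin_half_gt0 ha.
set S := fun j : 'I_k => sin (anode alpha j / 2); set Cs := fun j : 'I_k => cos (anode alpha j / 2).
set x := fun j : 'I_k => cos (cnode j).
have Cge j : 0 < Cs j by apply: lt_le_trans (cos_anode_ge j ha); exact: cos_half_gt0 ha.
have SE j : S j = s * x j by exact: anode_sin.
have xr j : x (rev_ord j) = - x j.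
  by rewrite /x cnode_rev cosD cosN sinN cos_PI sin_PI mul0r subr0 mulN1r.
have Cr j : Cs (rev_ord j) = Cs j by rewrite /Cs anode_rev mulNr cosN.
pose X (j : 'I_k) : R := 2 * `|S i * Cs j - Cs i * S j|; pose Y (j : 'I_k) : R := 2 * `|S i * Cs j + Cs i * S j|.
pose r := rev_ord i.
have nri : r != i.
  apply: contraNneq evk => ri; have := congr1 val ri; rewrite /= => /eqP.
  rewrite -(eqn_add2r i.+1) subnK ?ltn_ord // => /eqP ->.
  by rewrite addnS addnn /= odd_double.
have PX : \prod_(j < k | j != i) (2 * `|sin ((anode alpha i - anode alpha j) / 2)|) =
    \prod_(j < k | j != i) X j.
  apply: eq_bigr => j _; rewrite /X -/(S i) (_ : (_ - _) / 2 = anode alpha i / 2 - anode alpha j / 2).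
    by rewrite sinD cosN sinN mulrN.
  by field.
have PY : \prod_(j < k | j != i) X j = \prod_(j < k | j != r) Y j.
  rewrite (reindex_inj rev_ord_inj) /=; apply: eq_big => [j|j _].
    by rewrite -(inj_eq rev_ord_inj) rev_ordK.
  by rewrite /X /Y Cr (SE (rev_ord j)) xr mulrN -SE mulrN opprK.
have PR : \prod_(j < k | j != i) (2 * s * `|x i - x j|) = \prod_(j < k | j != r) (2 * s * `|x i + x j|).
  rewrite (reindex_inj rev_ord_inj) /=; apply: eq_big => [j|j _].
    by rewrite -(inj_eq rev_ord_inj) rev_ordK.
  by rewrite xr opprK.
(* Squares are compared, one copy of each product being reflected by [rev_ord]. Away from [i] and
   [r] the factors [X j] and [Y j] combine into a difference of squared sines; the unpaired factors
   [X r] and [Y i] contribute one [Cs i] each. *)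
rewrite PX; apply/eqP; rewrite -(eqrXn2 (n := 2)) //; last 2 first.
- by apply: prodr_ge0 => j _; rewrite mulr_ge0.
- by rewrite mulr_ge0 ?(ltW (Cge _)) //; apply: prodr_ge0 => j _; rewrite !mulr_ge0 // ltW.
apply/eqP; rewrite expr2 {2}PY exprMn [in RHS]expr2 [in RHS](expr2 (\prod_(_ < _ | _) _)) {2}PR.
rewrite (bigD1 r) //= [X in _ * X](bigD1 i) 1?eq_sym //=.
rewrite [in RHS](bigD1 r) //= [X in _ = _ * (_ * X)](bigD1 i) 1?eq_sym //=.
have -> : X r = Cs i * (2 * s * `|x i - x r|).
  rewrite /X Cr SE /r xr SE xr mulrN opprK.
  rewrite (_ : _ + _ = Cs i * s * (x i + x i)); last by ring.
  by rewrite !normrM (gtr0_norm (Cge i)) (gtr0_norm s0); ring.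
have -> : Y i = Cs i * (2 * s * `|x i + x i|).
  rewrite /Y SE (_ : _ + _ = Cs i * s * (x i + x i)); last by ring.
  by rewrite !normrM (gtr0_norm (Cge i)) (gtr0_norm s0); ring.
have E : \prod_(j < k | (j != i) && (j != r)) X j * \prod_(j < k | (j != r) && (j != i)) Y j =
   \prod_(j < k | (j != i) && (j != r)) (2 * s * `|x i - x j|) *
   \prod_(j < k | (j != r) && (j != i)) (2 * s * `|x i + x j|).
  rewrite [in RHS](eq_bigl _ _ (fun j => andbC (j != r) (j != i))).
  rewrite [in X in _ * X = _](eq_bigl _ _ (fun j => andbC (j != r) (j != i))).
  rewrite -!big_split /=; apply: eq_bigr => j _; rewrite /X /Y.
  have h1 := sin_cos1 (anode alpha i / 2); have h2 := sin_cos1 (anode alpha j / 2).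
  rewrite -/(S i) -/(Cs i) in h1; rewrite -/(S j) -/(Cs j) in h2.
  transitivity (4 * `|(S i * Cs j - Cs i * S j) * (S i * Cs j + Cs i * S j)|).
    by rewrite normrM; ring.
  rewrite (_ : _ * _ = (S i - S j) * (S i + S j)); last first.
    transitivity (S i ^+ 2 * Cs j ^+ 2 - Cs i ^+ 2 * S j ^+ 2); first by ring.
    have [-> ->] : Cs i ^+ 2 = 1 - S i ^+ 2 /\ Cs j ^+ 2 = 1 - S j ^+ 2 by split; [rewrite -h1 | rewrite -h2]; ring.
    ring.
  rewrite !SE -mulrBr -mulrDr !normrM (gtr0_norm s0); ring.
move: E.
set p1 := \prod_(_ < _ | _) X _; set p2 := \prod_(_ < _ | _) Y _.
set p3 := \prod_(_ < _ | _) (2 * s * `|_ - _|); set p4 := \prod_(_ < _ | _) (2 * s * `|_ + _|).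
move=> E; transitivity (Cs i * (2 * s * `|x i - x r|) * (Cs i * (2 * s * `|x i + x i|)) * (p1 * p2)); first by ring.
by rewrite E -/(Cs i) -/(x i) -/(x r); ring.
Qed.

(** * Unions of arcs and their Blaschke product *)

(** The rate [sin (alpha / 2)] is the capacity of an arc of length [2 alpha]. The factor [k + 1]
    later cancels the number of fibres in the Lagrange sum. *)
Lemma anode_prod_ge (alpha : R) k (i : 'I_k.+1) : 0 < alpha < PI -> odd k ->
  k.+1%:R * cos (alpha / 2) * sin (alpha / 2) ^+ k <=
  \prod_(j < k.+1 | j != i) (2 * `|sin ((anode alpha i - anode alpha j) / 2)|).
Proof.
move=> ha ok; rewrite anode_prod //= ?ok // big_split /= prodr_const.
rewrite (eq_card (B := predC1 i)) // cardC1 card_ord /= exprMn.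
have s0 := sin_half_gt0 ha; have c0 := cos_half_gt0 ha.
have h1 := cheb_prod_deriv i; have h2 := cos_anode_ge i ha.
set D := \prod_(_ < _ | _) _ in h1 *.
rewrite (_ : _ * (_ * D) = cos (anode alpha i / 2) * (2 ^+ k * D) * sin (alpha / 2) ^+ k); last by ring.
rewrite ler_wpM2r ?exprn_ge0 ?(ltW s0) // mulrC.
by apply: ler_pM => //; exact: ltW.
Qed.

Lemma sin_half_pos (x : R) : 0 < x < 2 * PI -> 0 < sin (x / 2).
Proof.
move=> /andP[h1 h2]; apply/RltP; apply: sin_gt_0; apply/RltP; first by rewrite divr_gt0.
lra.
Qed.

Lemma sin_half_ge (d x : R) : 0 < d -> d <= x <= 2 * PI - d -> sin (d / 2) <= sin (x / 2).
Proof.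
move=> d0 /andP[h1 h2]; rewrite -subr_ge0.
have -> : sin (x / 2) - sin (d / 2) = 2 * cos ((x + d) / 2 / 2) * sin ((x - d) / 2 / 2).
  have -> : x / 2 = (x + d) / 2 / 2 + (x - d) / 2 / 2 by field.
  have -> : d / 2 = (x + d) / 2 / 2 - (x - d) / 2 / 2 by field.
  by rewrite !sinD cosN sinN; ring.
have p0 : 0 < PI by apply/RltP; exact: PI_RGT_0.
have [g1 [g2 [g3 g4]]] : - (PI / 2) <= (x + d) / 2 / 2 /\ (x + d) / 2 / 2 <= PI / 2 /\
    0 <= (x - d) / 2 / 2 /\ (x - d) / 2 / 2 <= PI.
  by split; [lra|split; [lra|split; lra]].
apply: mulr_ge0; first apply: mulr_ge0 => //.
  by apply/RleP; apply: cos_ge_0; apply/RleP.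
by apply/RleP; apply: sin_ge_0; apply/RleP.
Qed.

Lemma continuity_bigprod (I : finType) (F : I -> R -> R) :
  (forall i, continuity (F i)) -> continuity (fun t => \prod_i F i t).
Proof.
move=> cF; elim: (index_enum I) => [|i r IH].
  by apply: (continuity_eq (f := fun=> 1)) => [t|]; [rewrite big_nil | exact: continuity_const].
apply: (continuity_eq (f := fun t => F i t * \prod_(j <- r) F j t)) => [t|].
  by rewrite big_cons.
exact: continuity_mult.
Qed.

Lemma continuity_sin_half (x : R) : continuity (fun t => sin ((t - x) / 2)).
Proof.
apply: (continuity_comp (fun t => (t - x) / 2) sin); last exact: continuity_sin.
apply: (continuity_eq (f := mult_real_fct (2^-1) (id - fct_cte x)%F)) => [t|].
  by rewrite /mult_real_fct /minus_fct /fct_cte /id RmultE RminusE mulrC.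
apply: continuity_scal; apply: continuity_minus.
  by apply: derivable_continuous; exact: derivable_id.
exact: continuity_const.
Qed.

Definition cpoly n (a : 'I_n -> R) : {poly C} := \prod_j ('X - (e (a j))%:P).

Definition spoly n (a : 'I_n -> R) (t : R) : R := \prod_j sin ((t - a j) / 2).

Lemma cpoly_e n (a : 'I_n -> R) t :
  (cpoly a).[e t] = (spoly a t)%:C * (2%:C * 'i) ^+ n * e ((n%:R * t + \sum_j a j) / 2).
Proof.
rewrite /cpoly /spoly horner_prod; elim: n a => [|n IH] a.
  by rewrite !big_ord0 mul0r addr0 mul0r e0 expr0 !mulr1.
rewrite !big_ord_recl IH hornerXsubC eB exprS (_ : n.+1%:R = n%:R + 1 :> R); last by rewrite -addn1 natrD.
rewrite [X in _ = _ * e X](_ : _ = (t + a ord0) / 2 + (n%:R * t + \sum_(i < n) a (lift ord0 i)) / 2); last by field.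
rewrite eD !rmorphM /=; ring.
Qed.

Lemma size_cpoly n (a : 'I_n -> R) : size (cpoly a) = n.+1.
Proof. by rewrite size_prod_XsubC /index_enum -enumT size_enum_ord. Qed.

Lemma cpoly_coef n (a : 'I_n -> R) : (cpoly a)`_n = 1.
Proof. by have := monic_prod_XsubC (index_enum 'I_n) xpredT (fun j => e (a j)); rewrite monicE lead_coefE size_cpoly => /eqP. Qed.

Lemma cpoly0 n (a : 'I_n -> R) : (cpoly a).[0] = (-1) ^+ n * e (\sum_j a j).
Proof.
rewrite /cpoly horner_prod; elim: n a => [|n IH] a; first by rewrite !big_ord0 e0 expr0 mulr1.
by rewrite !big_ord_recl IH hornerXsubC eD exprS sub0r; ring.
Qed.

Lemma normc_cpoly_le n (a : 'I_n -> R) t : normc (cpoly a).[e t] <= 2 ^+ n.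
Proof.
rewrite /cpoly horner_prod normc_prod -[n in leRHS]card_ord -prodr_const.
apply: ler_prod => j _; rewrite normc_ge0 /= hornerXsubC.
by apply: le_trans (le_normcD _ _) _; rewrite normcN !normc_e.
Qed.

(** The margin [d] at both ends of the window keeps the arcs apart across the cut [t0] as well, and
    makes [e t0] a point in a gap. *)
Definition separated n (a b : 'I_n -> R) (t0 d : R) : Prop :=
  [/\ 0 < d, forall j, a j < b j, forall j, t0 + d <= a j /\ b j <= t0 + 2 * PI - d
    & forall i j, i != j -> b i + d <= a j \/ b j + d <= a i].

Definition on_arcs n (a b : 'I_n -> R) (t : R) : Prop := exists j, a j <= t <= b j.

Lemma separated_window n (a b : 'I_n -> R) t0 d j l t :
  separated a b t0 d -> a j <= t <= b j -> - (2 * PI) < t - a l < 2 * PI /\ - (2 * PI) < t - b l < 2 * PI.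
Proof.
move=> [d0 ab win _] /andP[h1 h2]; have [w1 w2] := win j; have [w3 w4] := win l.
by have := ab l; have := ab j => ? ?; split; apply/andP; split; lra.
Qed.

Lemma sin_half_neq0 (x : R) : - (2 * PI) < x < 2 * PI -> x != 0 -> sin (x / 2) != 0.
Proof.
move=> /andP[h1 h2] x0; case: (ltgtP x 0) x0 => // [xlt|xgt] _.
  have := @sin_half_pos (- x); rewrite mulNr sinN => h.
  by rewrite lt_eqF // -oppr_gt0 h //; apply/andP; split; lra.
by rewrite gt_eqF // sin_half_pos // xgt.
Qed.

Lemma spoly_neq0 n (a b : 'I_n -> R) t0 d j t :
  separated a b t0 d -> a j < t < b j -> spoly a t != 0.
Proof.
move=> S /andP[h1 h2]; apply/prodf_neq0 => l _; apply: sin_half_neq0.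
  by have [] := separated_window l S (_ : a j <= t <= b j); rewrite ?(ltW h1) ?(ltW h2).
have [d0 ab _ sep] := S; have [->|nlj] := eqVneq l j; first by rewrite subr_eq0 gt_eqF.
by have [h|h] := sep l j nlj; have := ab l; have := ab j => ? ?; rewrite subr_eq0; apply/eqP; lra.
Qed.

(* The endpoints of the [j]-th arc are on the same side of every other arc, so only the [j]-th factors
   have opposite signs. *)
Lemma spoly_endpoints n (a b : 'I_n -> R) t0 d j :
  separated a b t0 d -> spoly b (a j) * spoly a (b j) < 0.
Proof.
move=> S; have [d0 ab win sep] := S.
have p0 : 0 < PI by apply/RltP; exact: PI_RGT_0.
have [wj1 wj2] := win j; have abj := ab j.
rewrite /spoly -big_split /= (bigD1 j) //= nmulr_rlt0.
  apply: prodr_gt0 => l nlj; have [wl1 wl2] := win l; have abl := ab l.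
  have [h|h] := sep l j nlj; first by rewrite mulr_gt0 ?sin_half_pos //; lra.
  rewrite -mulrNN -!sinN -!mulNr mulr_gt0 ?sin_half_pos //; lra.
rewrite -opprB mulNr sinN mulNr oppr_lt0 mulr_gt0 ?sin_half_pos //; lra.
Qed.

(** For [p = sin ((tau + alpha) / 2)] and [q = sin ((tau - alpha) / 2)] the equation says that the
    Blaschke product takes the value [e tau] at [e t]. The difference of the two sides changes sign
    along the arc, because each endpoint kills one term. A sigma type lets the nodes be selected by
    [sval]. *)
Lemma arc_node n (a b : 'I_n -> R) t0 d (p q : R) j :
  separated a b t0 d -> 0 < p -> q < 0 ->
  {t : R | a j < t < b j /\ p * spoly b t = q * spoly a t}.
Proof.
move=> S p0 q0; have abj : a j < b j by have [] := S.
pose f t := p * spoly b t - q * spoly a t.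
have sb0 : spoly b (b j) = 0 by rewrite /spoly (bigD1 j) //= subrr mul0r sin_0 mul0r.
have sa0 : spoly a (a j) = 0 by rewrite /spoly (bigD1 j) //= subrr mul0r sin_0 mul0r.
have fab : f (a j) * f (b j) < 0.
  rewrite /f sa0 sb0 (_ : _ * _ = (p * - q) * (spoly b (a j) * spoly a (b j))); last by ring.
  by rewrite pmulr_rlt0 ?mulr_gt0 ?oppr_gt0 //; exact: spoly_endpoints S.
have cf : continuity f.
  by apply: continuity_minus; apply: continuity_scal; apply: continuity_bigprod => i; exact: continuity_sin_half.
have [t [[/RleP h1 /RleP h2] ft]] : {z : R | (Rle (a j) z /\ Rle z (b j)) /\ f z = 0}.
  by apply: IVT_cor => //; apply/RleP; apply: ltW.
exists t; split; last by apply/eqP; rewrite -subr_eq0; apply/eqP.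
apply/andP; split; rewrite lt_neqAle ?h1 ?h2 andbT; apply: contraTneq fab => E.
  by rewrite E ft mul0r ltxx.
by rewrite -E ft mulr0 ltxx.
Qed.

(** Up to a nonzero constant, the numerator of [phi - e tau] for the Blaschke product [phi = (e (-
    alpha) b - e alpha a) / (b - a)]. This product is never formed; only its fibres are used. *)
Definition fiber_poly n (a b : 'I_n -> R) (alpha tau : R) : {poly C} :=
  ((sin ((tau + alpha) / 2))%:C * e (- alpha)) *: cpoly b - (sin ((tau - alpha) / 2))%:C *: cpoly a.

Lemma fiber_poly_e n (a b : 'I_n -> R) alpha tau t :
  \sum_j (b j - a j) = 2 * alpha ->
  (fiber_poly a b alpha tau).[e t] =
  (sin ((tau + alpha) / 2) * spoly b t - sin ((tau - alpha) / 2) * spoly a t)%:C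
    * ((2%:C * 'i) ^+ n * e ((n%:R * t + \sum_j a j) / 2)).
Proof.
rewrite sumrB => sab; rewrite /fiber_poly hornerD hornerN !hornerZ !cpoly_e.
rewrite (_ : \sum_j b j = 2 * alpha + \sum_j a j); last by rewrite -sab subrK.
rewrite (_ : (n%:R * t + _) / 2 = alpha + (n%:R * t + \sum_j a j) / 2); last by field.
rewrite eD; set E := e ((_ + _) / 2).
have e1 : e (- alpha) * e alpha = 1 by rewrite -eD addNr e0.
rewrite rmorphB !rmorphM /=.
transitivity ((sin ((tau + alpha) / 2))%:C * (spoly b t)%:C * (2%:C * 'i) ^+ n * E * (e (- alpha) * e alpha)
  - (sin ((tau - alpha) / 2))%:C * (spoly a t)%:C * (2%:C * 'i) ^+ n * E); first by ring.
by rewrite e1; ring.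
Qed.

Lemma fiber_lead (alpha tau : R) :
  (sin ((tau + alpha) / 2))%:C * e (- alpha) - (sin ((tau - alpha) / 2))%:C =
  (sin alpha)%:C * e (- (tau + alpha) / 2).
Proof.
have -> : - (tau + alpha) / 2 = - (tau / 2) - alpha / 2 by field.
have -> : sin alpha = sin (alpha / 2 + alpha / 2) by congr sin; field.
have -> : (tau + alpha) / 2 = tau / 2 + alpha / 2 by field.
have -> : (tau - alpha) / 2 = tau / 2 - alpha / 2 by field.
have -> : - alpha = - (alpha / 2) - alpha / 2 by field.
rewrite /e !sinD !cosD !sinN !cosN.
have h1 := sin_cos1 (alpha / 2).
have h2 : sin (alpha / 2) ^+ 2 = 1 - cos (alpha / 2) ^+ 2 by lra.
move: (sin (tau / 2)) (cos (tau / 2)) (sin (alpha / 2)) (cos (alpha / 2)) h2 => S K s c h2.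
by apply/eqP; rewrite eq_complex /=; apply/andP; split; apply/eqP; ring: h2.
Qed.

Lemma fiber_poly_coef n (a b : 'I_n -> R) alpha tau :
  (fiber_poly a b alpha tau)`_n = (sin alpha)%:C * e (- (tau + alpha) / 2).
Proof. by rewrite /fiber_poly coefB !coefZ !cpoly_coef !mulr1 fiber_lead. Qed.

(** The [n] distinct roots exhaust the degree, so evaluating the fibre polynomial gives the product
    of the distances from a point to a whole fibre. The leading coefficient has modulus
    [|sin alpha|] for every [tau]. *)
Lemma fiber_polyE n (a b : 'I_n -> R) alpha tau (z : 'I_n -> C) :
  sin alpha != 0 -> injective z -> (forall j, root (fiber_poly a b alpha tau) (z j)) ->
  fiber_poly a b alpha tau = ((sin alpha)%:C * e (- (tau + alpha) / 2)) *: \prod_j ('X - (z j)%:P).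
Proof.
move=> sa zi rz; have cn := fiber_poly_coef a b alpha tau.
have c0 : (fiber_poly a b alpha tau)`_n != 0.
  by rewrite cn -normc_eq0 normcM normc_e normcr mulr1 normr_eq0.
have sz : size (fiber_poly a b alpha tau) = n.+1.
  apply/eqP; rewrite eqn_leq; apply/andP; split.
    apply: leq_trans (size_polyD _ _) _; rewrite geq_max size_polyN.
    by rewrite !(leq_trans (size_scale_leq _ _)) ?size_cpoly.
  by rewrite ltnNge; apply: contraNN c0 => h; rewrite nth_default.
rewrite [LHS](@all_roots_prod_XsubC _ _ [seq z j | j <- enum 'I_n]).
- by rewrite lead_coefE sz cn big_image.
- by rewrite size_map size_enum_ord sz.
- by apply/allP => _ /mapP[j _ ->].
- by rewrite uniq_rootsE map_inj_uniq ?enum_uniq.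
Qed.

Definition gap_poly n (a b : 'I_n -> R) : {poly C} := cpoly b - cpoly a.

Lemma normc_two_i n : normc ((2%:C * 'i : C) ^+ n) = 2 ^+ n.
Proof. by rewrite normcX normcM normci normcr normr_nat mulr1. Qed.

Lemma normc_gap_poly_le n (a b : 'I_n -> R) t : normc (gap_poly a b).[e t] <= 2 ^+ n.+1.
Proof.
rewrite hornerD hornerN exprS mulr2n mulrDl mul1r.
by apply: le_trans (le_normcD _ _) _; rewrite normcN lerD ?normc_cpoly_le.
Qed.

(** The constant terms of [a] and [b] are unimodular with quotient [e (2 alpha)], so only the total
    length matters. *)
Lemma gap_poly0 n (a b : 'I_n -> R) alpha :
  \sum_j (b j - a j) = 2 * alpha -> normc (gap_poly a b).[0] = 2 * `|sin alpha|.
Proof.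
rewrite sumrB => sab; rewrite hornerD hornerN !cpoly0 -mulrBr normcM normcX normcN normc1 expr1n mul1r.
by rewrite normc_eB sab (_ : 2 * alpha / 2 = alpha) //; field.
Qed.

Lemma gap_poly_e n (a b : 'I_n -> R) alpha t :
  \sum_j (b j - a j) = 2 * alpha ->
  normc (gap_poly a b).[e t] = 2 ^+ n * normc ((spoly b t)%:C * e alpha - (spoly a t)%:C).
Proof.
rewrite sumrB => sab; rewrite hornerD hornerN !cpoly_e.
rewrite (_ : \sum_j b j = 2 * alpha + \sum_j a j); last by rewrite -sab subrK.
rewrite (_ : (n%:R * t + _) / 2 = alpha + (n%:R * t + \sum_j a j) / 2); last by field.
rewrite eD; set E := e ((_ + _) / 2).
rewrite (_ : _ - _ = (2%:C * 'i) ^+ n * E * ((spoly b t)%:C * e alpha - (spoly a t)%:C)); last by ring.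
by rewrite !normcM normc_two_i normc_e mulr1.
Qed.

Lemma gap_poly_node n (a b : 'I_n -> R) alpha tau t :
  \sum_j (b j - a j) = 2 * alpha -> 0 < sin ((tau + alpha) / 2) ->
  sin ((tau + alpha) / 2) * spoly b t = sin ((tau - alpha) / 2) * spoly a t ->
  sin ((tau + alpha) / 2) * normc (gap_poly a b).[e t] = `|sin alpha| * 2 ^+ n * `|spoly a t|.
Proof.
move=> sab s0 E; rewrite (gap_poly_e _ sab) mulrCA.
rewrite (_ : _ * normc _ = normc ((sin ((tau + alpha) / 2))%:C * ((spoly b t)%:C * e alpha - (spoly a t)%:C))); last first.
  by rewrite normcM normcr gtr0_norm.
rewrite mulrBr mulrA -rmorphM E rmorphM.
have h : e (- alpha) * e alpha = 1 by rewrite -eD addNr e0.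
rewrite (_ : _ - _ = - ((spoly a t)%:C * e alpha *
   ((sin ((tau + alpha) / 2))%:C * e (- alpha) - (sin ((tau - alpha) / 2))%:C))).
  by rewrite fiber_lead normcN !normcM !normc_e !normcr !mulr1; ring.
transitivity (- ((spoly a t)%:C * ((sin ((tau + alpha) / 2))%:C * (e (- alpha) * e alpha)
    - (sin ((tau - alpha) / 2))%:C * e alpha))); last by ring.
by rewrite h; ring.
Qed.

(** This is [|phi z - e tau'| = |e tau - e tau'|] for [z = e t] over [e tau], multiplied by half the
    modulus of the denominator [b - a]. *)
Lemma fiber_poly_node n (a b : 'I_n -> R) alpha tau tau' t :
  \sum_j (b j - a j) = 2 * alpha -> 0 < sin ((tau + alpha) / 2) ->
  sin ((tau + alpha) / 2) * spoly b t = sin ((tau - alpha) / 2) * spoly a t ->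
  normc (fiber_poly a b alpha tau').[e t] = `|sin ((tau - tau') / 2)| * normc (gap_poly a b).[e t].
Proof.
move=> sab s0 E; apply: (mulfI (lt0r_neq0 s0)); rewrite mulrCA (gap_poly_node sab s0 E).
rewrite (fiber_poly_e _ _ sab) !normcM normc_two_i normc_e mulr1 normcr mulrA.
rewrite -[X in X * `|_ - _|](gtr0_norm s0) -normrM mulrBr mulrCA E.
rewrite (_ : _ - _ = sin alpha * sin ((tau - tau') / 2) * spoly a t); first by rewrite !normrM; ring.
have {E} -> : (tau - tau') / 2 = tau / 2 - tau' / 2 by field.
have -> : (tau' + alpha) / 2 = tau' / 2 + alpha / 2 by field.
have -> : (tau + alpha) / 2 = tau / 2 + alpha / 2 by field.
have -> : (tau - alpha) / 2 = tau / 2 - alpha / 2 by field.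
have -> : (tau' - alpha) / 2 = tau' / 2 - alpha / 2 by field.
have -> : sin alpha = sin (alpha / 2 + alpha / 2) by congr sin; field.
by rewrite !sinD !sinN !cosN; ring.
Qed.

(** * Interpolation on a union of arcs *)

Lemma prod_pair_neq (I J : finType) (G : I * J -> R) i j :
  \prod_(l | l != (i, j)) G l =
  (\prod_(i' | i' != i) \prod_j' G (i', j')) * \prod_(j' | j' != j) G (i, j').
Proof.
rewrite (bigID (fun l : I * J => l.1 != i)) /=; congr (_ * _).
  rewrite pair_big_dep /=; apply: eq_big => [[i' j']|[i' j'] _] //=.
  by rewrite xpair_eqE; case: (i' == i); case: (j' == j).
transitivity (\prod_(i' | i' == i) \prod_(j' | j' != j) G (i', j')); last by rewrite big_pred1_eq.
rewrite pair_big_dep /=.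
apply: eq_big => [[i' j']|[i' j'] _] //=.
by rewrite xpair_eqE; case: (i' == i); case: (j' == j).
Qed.

Lemma e_separated n (a b : 'I_n -> R) t0 d j j' t t' :
  separated a b t0 d -> j != j' -> a j < t < b j -> a j' < t' < b j' ->
  2 * sin (d / 2) <= normc (e t - e t').
Proof.
move=> S; have [d0 _ win sep] := S.
wlog h : j j' t t' / b j' + d <= a j.
  move=> W nj hj hj'; have [h|h] := sep j j' nj; last exact: (W j j').
  by rewrite normcB; apply: (W j' j); rewrite 1?eq_sym.
move=> nj /andP[h1 h2] /andP[h3 h4]; rewrite normc_eB ler_pM2l //.
have [w1 w2] := win j; have [w3 w4] := win j'.
apply: le_trans (ler_norm _); apply: sin_half_ge => //.
by apply/andP; split; lra.
Qed.

Lemma d_lt_pi n (a b : 'I_n -> R) t0 d (j : 'I_n) : separated a b t0 d -> 0 < d < 2 * PI.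
Proof.
move=> [d0 ab win _]; have [w1 w2] := win j; have abj := ab j.
by apply/andP; split; lra.
Qed.

Theorem arc_interpolation n (a b : 'I_n -> R) t0 d alpha :
  separated a b t0 d -> \sum_j (b j - a j) = 2 * alpha -> 0 < alpha < PI ->
  exists2 K : R, 0 < K & forall (k : nat) (kap p : {poly C}) (M : R),
    odd k -> (size kap <= (n.-1 * k.+1).+1)%N -> (size p <= k.+1)%N ->
    (forall t, on_arcs a b t -> normc kap.[e t] <= normc (gap_poly a b).[e t] ^+ k.+1) ->
    (forall t, on_arcs a b t -> normc p.[e t] <= M) ->
    normc kap.[0] * normc p.[0] * sin (alpha / 2) ^+ k <= K * M * (2 * sin alpha) ^+ k.+1.
Proof.
case: n a b => [|n] a b S sab ha.
  by move: sab; rewrite big_ord0 => h; have /andP[? _] := ha; exfalso; lra.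
have /andP[a0 api] := ha.
set s := sin (alpha / 2); set c := cos (alpha / 2).
have s0 : 0 < s := sin_half_gt0 ha; have c0 : 0 < c := cos_half_gt0 ha.
have sa0 : 0 < sin alpha by apply/RltP; apply: sin_gt_0; apply/RltP.
pose g := 2 * sin (d / 2).
have g0 : 0 < g by rewrite mulr_gt0 // sin_half_pos //; exact: d_lt_pi ord0 S.
(* Here [2 ^ (n + 2)] bounds the one factor [|b - a|] that the weights leave uncancelled, [g ^ n]
   bounds from below the distances within a fibre, and [n + 1] counts the arcs. *)
exists (n.+1%:R * 2 ^+ n.+2 / (2 * sin alpha * c * g ^+ n)).
  have p2 : 0 < 2 ^+ n.+2 :> R by rewrite exprn_gt0.
  have gn : 0 < g ^+ n by rewrite exprn_gt0.
  by apply: divr_gt0; apply: mulr_gt0 => //; rewrite ?ltr0n // !mulr_gt0.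
move=> k kap p M ok szk szp kapE pE.
pose tau (i : 'I_k.+1) := anode alpha i.
have tb i : - alpha < tau i < alpha by exact: anode_bound.
have P0 i : 0 < sin ((tau i + alpha) / 2).
  by have /andP[h1 h2] := tb i; apply: sin_half_pos; apply/andP; split; lra.
have Q0 i : sin ((tau i - alpha) / 2) < 0.
  have /andP[h1 h2] := tb i; rewrite -opprB mulNr sinN oppr_lt0.
  by apply: sin_half_pos; apply/andP; split; lra.
pose T (l : 'I_k.+1 * 'I_n.+1) := sval (arc_node l.2 S (P0 l.1) (Q0 l.1)).
have TI l : a l.2 < T l < b l.2 by rewrite /T; case: (arc_node _ _ _ _) => t [].
have TE l : sin ((tau l.1 + alpha) / 2) * spoly b (T l) = sin ((tau l.1 - alpha) / 2) * spoly a (T l).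
  by rewrite /T; case: (arc_node _ _ _ _) => t [].
have Ton l : on_arcs a b (T l) by exists l.2; have /andP[h1 h2] := TI l; rewrite !ltW.
pose z l := e (T l); pose V l := normc (gap_poly a b).[z l].
have V0 l : 0 < V l.
  rewrite -(pmulr_rgt0 _ (P0 l.1)) (gap_poly_node sab (P0 _) (TE l)).
  have p2 : 0 < 2 ^+ n.+1 :> R by rewrite exprn_gt0.
  by rewrite !mulr_gt0 ?normr_gt0 ?(lt0r_neq0 sa0) ?(spoly_neq0 S (TI l)).
pose D i i' := 2 * `|sin ((tau i - tau i') / 2)|.
have Dge i : k.+1%:R * c * s ^+ k <= \prod_(i' | i' != i) D i i' by exact: anode_prod_ge.
have D0 i i' : i' != i -> 0 < D i i'.
  move=> ni; rewrite lt_neqAle mulr_ge0 // andbT eq_sym.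
  have sk : 0 < s ^+ k by rewrite exprn_gt0.
  have /lt_le_trans-/(_ _ (Dge i)) : 0 < k.+1%:R * c * s ^+ k by rewrite !mulr_gt0 // ltr0n.
  by move=> /lt0r_neq0/prodf_neq0; apply.
have rootF i j : root (fiber_poly a b alpha (tau i)) (z (i, j)).
  by rewrite /root -normc_eq0 (fiber_poly_node _ sab (P0 i) (TE (i, j))) subrr mul0r sin_0 normr0 mul0r.
have zij i j j' : j != j' -> g <= normc (z (i, j) - z (i, j')).
  by move=> nj; apply: (e_separated S nj); [exact: (TI (i, j)) | exact: (TI (i, j'))].
have zj_inj i : injective (fun j => z (i, j)).
  move=> j j' /= E; apply: contraTeq g0 => nj; have := zij i j j' nj.
  by rewrite E subrr normc0 -leNgt.
have Fz l i : normc (fiber_poly a b alpha (tau i)).[z l] = `|sin ((tau l.1 - tau i) / 2)| * V l.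
  exact: fiber_poly_node sab (P0 _) (TE l).
have zinj : injective z.
  move=> [i j] [i' j'] E; have [ii|ni] := eqVneq i' i.
    by rewrite ii in E *; rewrite (zj_inj _ _ _ E).
  have := Fz (i, j) i'; rewrite E (eqP (rootF i' j')) normc0 => /esym/eqP.
  by rewrite mulf_eq0 (gt_eqF (V0 _)) orbF => h; have := D0 i i' ni; rewrite /D (eqP h) mulr0 ltxx.
have block l i' : \prod_j' normc (z l - z (i', j')) = D l.1 i' * (V l / (2 * sin alpha)).
  have := Fz l i'; rewrite (fiber_polyE (lt0r_neq0 sa0) (zj_inj i') (rootF i')).
  rewrite hornerZ horner_prod !normcM normcr normc_e mulr1 normc_prod (gtr0_norm sa0).
  under eq_bigr => j _ do rewrite hornerXsubC.
  move=> h; apply: (mulfI (lt0r_neq0 sa0)); rewrite h /D; field.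
  exact: lt0r_neq0.
(* The [k] foreign fibres are evaluated by [block]. In the own fibre, where that formula would
   contain a vanishing factor, the gaps between the arcs give [g ^ n]. *)
have low l : k.+1%:R * c * s ^+ k * (V l / (2 * sin alpha)) ^+ k * g ^+ n <=
    \prod_(l' | l' != l) normc (z l - z l').
  case: l => i j; rewrite prod_pair_neq; under eq_bigr => i' _ do rewrite block.
  rewrite big_split /= prodr_const (eq_card (B := predC1 i)) // cardC1 card_ord /=.
  apply: ler_pM; rewrite ?exprn_ge0 ?(ltW g0) //.
    by rewrite !mulr_ge0 ?exprn_ge0 ?divr_ge0 ?mulr_ge0 ?ler0n // ltW.
    by rewrite ler_wpM2r // ?exprn_ge0 ?divr_ge0 ?mulr_ge0 // ltW.
  rewrite -[n in leLHS]/(n.+1.-1) -[n.+1 in leLHS]card_ord -(cardC1 j) -prodr_const.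
  rewrite (eq_bigl (fun j' => j' != j)) //; apply: ler_prod => j' nj.
  by rewrite (ltW g0) zij 1?eq_sym.
have szA : (size (kap * p)%R <= #|{: 'I_k.+1 * 'I_n.+1}|)%N.
  rewrite card_prod !card_ord; apply: leq_trans (size_polyMleq _ _) _.
  have h : (size kap + size p <= (n * k.+1).+1 + k.+1)%N by exact: leq_add.
  by rewrite -subn1 leq_subLR (leq_trans h) // (mulnS k.+1 n) (mulnC k.+1 n) add1n addSn ltnS addnC.
have M0 : 0 <= M by apply: le_trans (normc_ge0 _) (pE _ (Ton (ord0, ord0))).
have k0 : 0 < k.+1%:R :> R by rewrite ltr0n.
have [sk gn ak] : [/\ 0 < s ^+ k, 0 < g ^+ n & 0 < (2 * sin alpha) ^+ k].
  by split; apply: exprn_gt0 => //; apply: mulr_gt0.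
pose L := k.+1%:R * c * s ^+ k * g ^+ n.
have L0 : 0 < L by rewrite /L !mulr_gt0.
have term l : normc (kap * p).[z l] / \prod_(l' | l' != l) normc (z l - z l') <=
    2 ^+ n.+2 * M * (2 * sin alpha) ^+ k / L.
  have Vk : 0 < V l ^+ k by rewrite exprn_gt0.
  have low0 : 0 < k.+1%:R * c * s ^+ k * (V l / (2 * sin alpha)) ^+ k * g ^+ n.
    by rewrite expr_div_n !mulr_gt0 // invr_gt0.
  apply: (@le_trans _ _ (V l ^+ k.+1 * M / (k.+1%:R * c * s ^+ k * (V l / (2 * sin alpha)) ^+ k * g ^+ n))).
    apply: ler_pM.
    - exact: normc_ge0.
    - by rewrite invr_ge0; apply: prodr_ge0 => l' _; exact: normc_ge0.
    - by rewrite hornerM normcM; apply: ler_pM; by [exact: normc_ge0 | exact: kapE | exact: pE].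
    - by rewrite lef_pV2 ?low // posrE // (lt_le_trans low0).
  rewrite (_ : _ / _ = V l * M * (2 * sin alpha) ^+ k / L); last first.
    rewrite /L exprS expr_div_n; field.
    by rewrite ?nat1r ?(lt0r_neq0 c0) ?(lt0r_neq0 k0) ?(lt0r_neq0 sk) ?(lt0r_neq0 gn) ?(lt0r_neq0 Vk) ?(lt0r_neq0 ak) ?(lt0r_neq0 sa0).
  rewrite ler_wpM2r ?invr_ge0 ?(ltW L0) // ler_wpM2r ?(ltW ak) // ler_wpM2r //.
  exact: normc_gap_poly_le.
have := lagrange_bound zinj (fun l => normc_e _) szA.
rewrite hornerM normcM => h.
have {}h := le_trans h (ler_sum _ (fun l _ => term l)).
rewrite sumr_const card_prod !card_ord -[_ *+ _]mulr_natl natrM in h.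
apply: le_trans (ler_wpM2r (ltW sk) h) _.
rewrite le_eqVlt; apply/orP; left; apply/eqP.
rewrite /L (exprS (2 * sin alpha)); field.
by rewrite ?nat1r ?(lt0r_neq0 c0) ?(lt0r_neq0 k0) ?(lt0r_neq0 sk) ?(lt0r_neq0 gn) ?(lt0r_neq0 sa0).
Qed.

(** * Lemniscate polynomials *)

Lemma bernoulli_le (x : R) N : 0 <= x -> 1 + N%:R * x <= (1 + x) ^+ N.
Proof.
move=> x0; elim: N => [|N IH]; first by rewrite mul0r addr0 expr0.
rewrite exprS -nat1r; have n0 : 0 <= N%:R :> R by rewrite ler0n.
have h : 0 <= N%:R * x * x by rewrite !mulr_ge0.
have := ler_wpM2l (_ : 0 <= 1 + x) IH; rewrite addr_ge0 // => /(_ isT).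
by lra.
Qed.

(** If [x > y > 0], Bernoulli's inequality pushes [(x / y)^N] beyond [K / c]. This replaces the
    extraction of [N]-th roots. *)
Lemma growth_compare (x y c K : R) : 0 <= y -> 0 < c -> 0 < x ->
  (forall N, (0 < N)%N -> x ^+ N * c <= K * y ^+ N) -> x <= y.
Proof.
move=> y0 c0 x0 h; rewrite leNgt; apply/negP => yx.
have [yE|y1] := eqVneq y 0.
  by have := h 1 isT; rewrite !expr1 yE mulr0 leNgt mulr_gt0.
have {y1} y1 : 0 < y by rewrite lt_neqAle eq_sym y1.
pose q := x / y - 1; have q0 : 0 < q by rewrite subr_gt0 ltr_pdivlMr // mul1r.
have h2 N : (0 < N)%N -> N%:R * q * c <= K.
  move=> N0.
  have yN : 0 < y ^+ N by rewrite exprn_gt0.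
  have hN : (x / y) ^+ N * c <= K.
    by rewrite expr_div_n mulrAC ler_pdivrMr //; exact: h.
  apply: le_trans hN; rewrite ler_wpM2r ?(ltW c0) //.
  have := bernoulli_le N (ltW q0); rewrite [1 + q]addrC /q subrK => hb.
  by apply: le_trans hb; rewrite lerDr.
have z0 : 0 <= `|K| / (q * c) by rewrite divr_ge0 ?mulr_ge0 ?(ltW q0) ?(ltW c0).
have := archi_boundP z0; set N := Num.bound _ => hN.
have N0 : (0 < N)%N by rewrite -(ltr0n R) (le_lt_trans z0).
move: hN; rewrite ltr_pdivrMr ?mulr_gt0 // ltNge mulrA (le_trans (h2 _ N0)) //.
exact: ler_norm.
Qed.

(** Consecutive power sums [(Y_N, Y_(N+1))] of the roots of [y^2 - 2 P y + Q], given by their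
    recurrence so that they are visibly polynomials in [P] and [Q]. *)
Fixpoint lucas (P Q : {poly C}) (N : nat) : {poly C} * {poly C} :=
  if N is N'.+1 then
    ((lucas P Q N').2, 2%:P * P * (lucas P Q N').2 - Q * (lucas P Q N').1)
  else (2%:P, 2%:P * P).

Lemma lucas_eval (P Q : {poly C}) (z y1 y2 : C) N :
  y1 + y2 = 2 * P.[z] -> y1 * y2 = Q.[z] -> (lucas P Q N).1.[z] = y1 ^+ N + y2 ^+ N.
Proof.
move=> hs hp; suff [] : (lucas P Q N).1.[z] = y1 ^+ N + y2 ^+ N /\
  (lucas P Q N).2.[z] = y1 ^+ N.+1 + y2 ^+ N.+1 by [].
elim: N => [|N [IH1 IH2]] /=; first by rewrite !hornerE hs.
split=> //; rewrite !hornerE IH1 IH2 -hs -hp !exprS; ring.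
Qed.

Lemma lucas_size (P Q : {poly C}) m N :
  (size P <= m.+1)%N -> (size Q <= m.+1)%N -> (size (lucas P Q N).1 <= (m * N).+1)%N.
Proof.
move=> sP sQ.
have sM (p q : {poly C}) i j : (size p <= i.+1)%N -> (size q <= j.+1)%N -> (size (p * q)%R <= (i + j).+1)%N.
  move=> h1 h2; apply: leq_trans (size_polyMleq _ _) _.
  by rewrite -subn1 leq_subLR (leq_trans (leq_add h1 h2)) // addSn addnS.
suff [] : (size (lucas P Q N).1 <= (m * N).+1)%N /\ (size (lucas P Q N).2 <= (m * N.+1).+1)%N by [].
have s2 : (size (2%:P * P : {poly C})%R <= m.+1)%N.
  by apply: (sM _ _ 0 m) => //; rewrite size_polyC; case: eqP.
elim: N => [|N [IH1 IH2]] /=; first by rewrite muln0 muln1 size_polyC; case: eqP.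
split=> //; apply: leq_trans (size_polyD _ _) _; rewrite geq_max size_polyN.
rewrite [(m * N.+2)%N]mulnS sM //=; apply: leq_trans (sM _ _ _ _ sQ IH1) _.
by rewrite ltnS leq_add2l leq_mul2l leqnSn orbT.
Qed.

Lemma lucas0 (P Q : {poly C}) N : Q.[0] = 0 -> (lucas P Q N.+1).1.[0] = (2 * P.[0]) ^+ N.+1.
Proof.
move=> q0; elim: N => [|N IH] /=; first by rewrite !hornerE.
by rewrite hornerD hornerN !hornerM q0 mul0r subr0 hornerC exprS -IH.
Qed.

Definition lemniscate_poly m (th : 'I_m -> R) (M : R) : nat -> {poly C} :=
  fun N => (lucas (cpoly th) (((M ^+ 2)%:C * (cpoly th).[0]) *: 'X^m) N).1.

Lemma lemniscate_poly_le m (th : 'I_m -> R) M N t :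
  normc (cpoly th).[e t] <= M -> normc (lemniscate_poly th M N).[e t] <= 2 * M ^+ N.
Proof.
have -> : normc (cpoly th).[e t] = `|2 ^+ m * spoly th t|.
  by rewrite cpoly_e !normcM normc_e normc_two_i normcr mulr1 normrM ger0_norm ?exprn_ge0 // mulrC.
set x := 2 ^+ m * spoly th t => xM; have M0 : 0 <= M := le_trans (normr_ge0 _) xM.
pose xi : C := 'i ^+ m * e ((m%:R * t + \sum_j th j) / 2).
(* On the circle [P = x xi] with [x] real and [xi] unimodular, so [y1] and [y2] are [xi (x +- i r)].
   Both have modulus [M]; the real square root is where [|x| <= M] enters. *)
pose r := Num.sqrt (M ^+ 2 - x ^+ 2).
have r2 : r ^+ 2 = M ^+ 2 - x ^+ 2.
  by rewrite sqr_sqrtr // subr_ge0 -[x ^+ 2]real_normK ?num_real // lerXn2r ?nnegrE.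
have xi1 : normc xi = 1 by rewrite normcM normcX normci expr1n normc_e mulr1.
have nM (s : R) : s ^+ 2 = r ^+ 2 -> normc (xi * (x +i* s)) = M.
  move=> sr; rewrite normcM xi1 mul1r /= sr r2 addrC subrK sqrtr_sqr.
  by rewrite ger0_norm.
rewrite /lemniscate_poly (@lucas_eval _ _ _ (xi * (x +i* r)) (xi * (x +i* (- r)))).
- apply: le_trans (le_normcD _ _) _; rewrite !normcX !nM ?sqrrN //.
  by rewrite mulr2n mulrDl mul1r.
- rewrite cpoly_e -mulrDr (_ : _ + _ = 2 * x%:C); last by apply/eqP; rewrite eq_complex /=; apply/andP; split; apply/eqP; ring.
  by rewrite /xi /x exprMn rmorphM rmorphXn /=; ring.
- rewrite hornerZ hornerXn cpoly0 mulrACA.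
  rewrite (_ : (x +i* r) * (x +i* (- r)) = (M ^+ 2)%:C); last first.
    by apply/eqP; rewrite eq_complex /= -[M ^+ 2](subrK (x ^+ 2)) -r2; apply/andP; split; apply/eqP; ring.
  have -> : e t ^+ m = e (m%:R * t).
    elim: (m) => [|j IH]; first by rewrite mul0r e0.
    by rewrite exprS IH -eD -nat1r; congr e; ring.
  have -> : xi * xi = (-1) ^+ m * (e (m%:R * t) * e (\sum_j th j)).
    rewrite /xi mulrACA -exprMn -expr2 sqr_i -!eD; congr (_ * e _).
    by field.
  by ring.
Qed.

Lemma size_exp_le (p : {poly C}) i j : (size p <= i.+1)%N -> (size (p ^+ j) <= (i * j).+1)%N.
Proof.
move=> h; apply: leq_trans (size_poly_exp_leq _ _) _.
by rewrite ltnS leq_mul2r -subn1 leq_subLR add1n h orbT.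
Qed.

Lemma lemniscate_poly_size m (th : 'I_m -> R) M N :
  (size (lemniscate_poly th M N) <= (m * N).+1)%N.
Proof.
apply: lucas_size; first by rewrite size_cpoly.
by apply: leq_trans (size_scale_leq _ _) _; rewrite size_polyXn.
Qed.

Lemma lemniscate_poly0 m (th : 'I_m -> R) M N :
  (0 < m)%N -> (0 < N)%N -> normc (lemniscate_poly th M N).[0] = 2 ^+ N.
Proof.
case: N => // N m0 _; rewrite /lemniscate_poly lucas0.
  rewrite normcX normcM cpoly0 normcM normcX normcN normc1 expr1n normc_e !mulr1.
  have -> : (2 : C) = (2 : R)%:C by rewrite rmorph_nat.
  by rewrite normcr normr_nat.
by rewrite hornerZ hornerXn expr0n eqn0Ngt m0 mulr0.
Qed.

(* Interpolation is applied to the [2 J N]-th lemniscate polynomial with [kap ^+ r]; letting [N] grow removes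
   the constant [K]. *)
Theorem arcs_bound_improved n (a b : 'I_n -> R) t0 d alpha m (th : 'I_m -> R) (M : R)
    (J : nat) (kap : {poly C}) (rho : R) :
  separated a b t0 d -> \sum_j (b j - a j) = 2 * alpha -> 0 < alpha < PI ->
  (0 < m)%N -> (0 < J)%N -> (size kap <= (n.-1 * J).+1)%N ->
  (forall t, on_arcs a b t -> normc kap.[e t] <= normc (gap_poly a b).[e t] ^+ J) ->
  0 < rho -> normc kap.[0] = rho * (2 * sin alpha) ^+ J ->
  0 <= M -> (forall t, on_arcs a b t -> normc (cpoly th).[e t] <= M) ->
  rho ^+ (2 * m) * (2 * sin (alpha / 2) ^+ m) ^+ (2 * J) <= M ^+ (2 * J).
Proof.
move=> S sab ha m0 J0 szk kapE rho0 kap0 M0 PM.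
have [K K0 interp] := arc_interpolation S sab ha.
have /andP[a0 api] := ha.
have s0 := sin_half_gt0 ha; set s := sin (alpha / 2) in s0 *.
have sa0 : 0 < sin alpha by apply/RltP; apply: sin_gt_0; apply/RltP.
have r2m : 0 < rho ^+ (2 * m) by rewrite exprn_gt0.
have ssJ : 0 < (2 * s ^+ m) ^+ (2 * J) by rewrite exprn_gt0 // mulr_gt0 ?exprn_gt0.
(* The factor [rho ^ 2 * s ^ (2 J - 1)] is what [rho ^ r * s ^ k] contains besides an [N]-th power;
   the [2] in [K * 2] comes from the bound [2 M ^ (2 J N)]. *)
apply: (@growth_compare _ _ (rho ^+ 2 * s ^+ (2 * J).-1) (K * 2)) => [|||N Npos].
- by rewrite exprn_ge0.
- by rewrite !mulr_gt0 ?exprn_gt0.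
- by rewrite mulr_gt0.
(* An even [r] makes [k = J r - 1] odd, and [J r = m (2 J N) + 2 J] leaves room for the degree
   [m (2 J N)] of the lemniscate polynomial. *)
pose r := (2 * (m * N).+1)%N; pose k := (J * r).-1.
have Jr0 : (0 < J * r)%N by rewrite muln_gt0 J0.
have kE : k.+1 = (J * r)%N by rewrite prednK.
have ok : odd k by rewrite -[odd k]negbK -oddS kE oddM oddM andbF.
have := interp k (kap ^+ r) (lemniscate_poly th M (2 * J * N)) (2 * M ^+ (2 * J * N)) ok.
rewrite kE horner_exp normcX kap0 lemniscate_poly0 ?muln_gt0 ?J0 //.
have h1 : (size (kap ^+ r)%R <= (n.-1 * (J * r)).+1)%N by rewrite mulnA; exact: size_exp_le.
have h2 : (size (lemniscate_poly th M (2 * J * N)) <= J * r)%N.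
  apply: leq_trans (lemniscate_poly_size _ _ _) _.
  have -> : (J * r = m * (2 * J * N) + 2 * J)%N by rewrite /r mulnS; ring.
  by rewrite -addn1 leq_add2l muln_gt0 J0.
move=> /(_ h1 h2) {h1 h2}.
have h3 t : on_arcs a b t -> normc (kap ^+ r).[e t] <= normc (gap_poly a b).[e t] ^+ (J * r).
  move=> ht; rewrite horner_exp normcX exprM.
  by apply: lerXn2r; rewrite ?nnegrE ?exprn_ge0 ?normc_ge0 //; exact: kapE.
have h4 t : on_arcs a b t -> normc (lemniscate_poly th M (2 * J * N)).[e t] <= 2 * M ^+ (2 * J * N).
  by move=> ht; apply: lemniscate_poly_le; exact: PM.
move=> /(_ h3 h4) {h3 h4} H.
have X0 : 0 < (2 * sin alpha) ^+ (J * r) by rewrite exprn_gt0 // mulr_gt0.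
rewrite -(ler_pM2r X0); apply: le_trans (le_trans _ H) _.
  have rE : r = (2 * m * N + 2)%N by rewrite /r mulnS; ring.
  have kE2 : k = (m * (2 * J) * N + (2 * J).-1)%N.
    apply/eqP; rewrite -eqSS kE -addnS prednK ?muln_gt0 ?J0 // /r mulnS; apply/eqP; ring.
  rewrite (exprMn _ (rho)) -(exprM (2 * sin alpha)) rE exprD (exprM rho) -rE kE2 (exprD s) !exprM.
  rewrite le_eqVlt; apply/orP; left; apply/eqP.
  by rewrite !exprMn -!exprM; ring.
by rewrite -[in leRHS]exprM !mulrA -[(K * 2) * _]mulrA.
Qed.

(** * Strict improvement for several arcs *)

Lemma normc_sqr (z : C) : normc z ^+ 2 = Re z ^+ 2 + Im z ^+ 2.
Proof. by case: z => x y /=; rewrite sqr_sqrtr // addr_ge0 ?sqr_ge0. Qed.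

Lemma Re_le_normc (z : C) : `|Re z| <= normc z.
Proof.
rewrite -(ler_pXn2r (n := 2)) ?nnegrE ?normc_ge0 // real_normK ?num_real // normc_sqr.
by rewrite lerDl sqr_ge0.
Qed.

Lemma pow_small (r eps : R) : 0 <= r -> r < 1 -> 0 < eps -> exists J, r ^+ J <= eps.
Proof.
move=> r0 r1 e0; apply: Classical_Prop.NNPP => H.
have := @growth_compare 1 r eps 1 r0 e0 ltr01; rewrite leNgt r1 => h.
apply: (elimF idP (erefl false)); apply: h => N _; rewrite expr1n !mul1r ltW // ltNge.
by apply/negP => hN; apply: H; exists N.
Qed.

(* [geo r J] is a truncation of [(1 + r X) / (1 - r X)], whose real part on the circle is the Poisson kernel
   peaking at [1]. *)
Definition geo (r : R) (J : nat) : {poly C} := 2%:P * (\sum_(j < J) ((r%:C)%:P * 'X) ^+ j) - 1.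

Lemma geo_le r J (z : C) : 0 <= r <= 1 -> normc z <= 1 -> normc (geo r J).[z] <= 2 * J%:R + 1.
Proof.
move=> /andP[r0 r1] z1; rewrite !hornerE horner_sum.
apply: le_trans (le_normcD _ _) _; rewrite normcN normc1 lerD2r normcM.
have -> : (2 : C) = (2 : R)%:C by rewrite rmorph_nat.
rewrite normcr normr_nat ler_wpM2l // (le_trans (normc_sum _)) //.
rewrite -[J in leRHS]card_ord -sum1_card natr_sum; apply: ler_sum => j _.
rewrite horner_exp !hornerE normcX exprn_ile1 ?normc_ge0 // normcM normcr ger0_norm //.
by rewrite mulr_ile1 ?normc_ge0.
Qed.

(** The geometric sum gives [geo z * (1 - r z) = 1 + r z - 2 (r z)^J]. Multiplication by the
    conjugate of [1 - r z] leaves the numerator of the Poisson kernel and an error of modulus at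
    most [2 r^J * 2]. *)
Lemma geo_Re r J (z : C) : 0 <= r <= 1 -> normc z <= 1 ->
  `|Re (geo r J).[z] * normc (1 - r%:C * z) ^+ 2 - (1 - r ^+ 2 * normc z ^+ 2)| <= 4 * r ^+ J.
Proof.
move=> /andP[r0 r1] z1; set q := 1 - r%:C * z.
have E : (geo r J).[z] * q = 1 + r%:C * z - 2 * (r%:C * z) ^+ J.
  rewrite !hornerE horner_sum /q.
  under eq_bigr => j _ do rewrite horner_exp !hornerE.
  have := subrX1 (r%:C * z) J; set S := \sum_(i < J) _ => hS.
  rewrite (_ : (r%:C * z) ^+ J = 1 + (r%:C * z - 1) * S); last by rewrite -hS; ring.
  by ring.
have q2 : normc q <= 2.
  apply: le_trans (le_normcD _ _) _; rewrite normc1 normcN normcM normcr ger0_norm //.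
  by rewrite lerD2l mulr_ile1 ?normc_ge0.
have E2 : Re (geo r J).[z] * normc q ^+ 2 - (1 - r ^+ 2 * normc z ^+ 2) =
    - Re (2 * (r%:C * z) ^+ J * q^*).
  have <- : Re ((geo r J).[z] * q * q^*) = Re (geo r J).[z] * normc q ^+ 2.
    by rewrite normc_sqr; case: (geo r J).[z] => x y; case: (q) => u v /=; ring.
  rewrite E mulrBl (_ : Re (_ - _) = Re ((1 + r%:C * z) * q^*) - Re (2 * (r%:C * z) ^+ J * q^*)).
    rewrite (_ : Re ((1 + r%:C * z) * q^*) = 1 - r ^+ 2 * normc z ^+ 2); first by ring.
    by rewrite normc_sqr /q; case: (z) => x y /=; ring.
  by case: (_ * q^*) => ? ?; case: (_ * _ * q^*) => ? ?.
rewrite E2 normrN (le_trans (Re_le_normc _)) // !normcM normcX normcM normcr ger0_norm //.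
have -> : (2 : C) = (2 : R)%:C by rewrite rmorph_nat.
have -> : normc q^* = normc q by case: (q) => u v /=; rewrite sqrrN.
rewrite normcr normr_nat exprMn.
have zJ : normc z ^+ J <= 1 by rewrite exprn_ile1 ?normc_ge0.
have rJ : 0 <= r ^+ J by rewrite exprn_ge0.
have zJ0 : 0 <= normc z ^+ J by rewrite exprn_ge0 ?normc_ge0.
have q0 := normc_ge0 q.
have h1 : r ^+ J * normc z ^+ J <= r ^+ J by rewrite -[leRHS]mulr1 ler_wpM2l.
have h2 : 0 <= r ^+ J * normc z ^+ J by rewrite mulr_ge0.
have h3 (u v w : R) : u <= w -> 0 <= u -> 0 <= v -> v <= 2 -> 2 * u * v <= 4 * w by nra.
exact: h3.
Qed.

(** The polynomial is [1 + eps w] with [w = geo - mu]. Its modulus exceeds [1] where [Re w > 0], and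
    is at most [1] where [Re w] is bounded away from [0] on the negative side and [eps] is small.
    The kernel is bounded below at the interior point [a0] and nearly zero on the circle away from
    [1], so a threshold [mu] separates the two. *)
Lemma peak (delta : R) (a0 : C) : 0 < delta -> normc a0 < 1 ->
  exists2 V : {poly C}, 1 < normc V.[a0] &
    forall z, normc z = 1 -> delta <= normc (z - 1) -> normc V.[z] <= 1.
Proof.
wlog d2 : delta / delta <= 2.
  move=> W d0 a1; have [h|h] := leP delta 2; first exact: W.
  have [V h1 h2] := W 2 (lexx 2) (ltr0n _ 2) a1.
  by exists V => // z z1 hz; apply: h2 => //; apply: le_trans hz; exact: ltW.
move=> d0 a1; pose A := 1 - normc a0 ^+ 2.
have a00 := normc_ge0 a0.
have A0 : 0 < A by rewrite /A; nra.
have A1 : A <= 1 by rewrite /A; nra.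
(* Away from [1] the real part of [geo] is then at most [t / (3 / 4 * delta ^ 2) = A / 24]: the
   choices of [r] and [J] bound [1 - r ^ 2] and [4 r ^ J] by [t / 2] each. *)
pose t := A * delta ^+ 2 / 32.
have d20 : 0 < delta ^+ 2 by rewrite exprn_gt0.
have d24 : delta ^+ 2 <= 4 by nra.
have t0 : 0 < t by rewrite divr_gt0 ?mulr_gt0.
have tA : t <= A / 8 by rewrite /t; nra.
pose r := 1 - t / 4; have r1 : r < 1 by rewrite /r; lra.
have r34 : 3 / 4 <= r by rewrite /r; lra.
have r0 : 0 <= r by lra.
have [J hJ] : exists J, r ^+ J <= t / 8 by apply: pow_small => //; rewrite divr_gt0.
have rr : 0 <= r <= 1 by rewrite r0 ltW.
(* The threshold [A / 8] lies above [A / 24] and below the real part of [geo] at [a0]. With this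
   [eps] the quadratic term, at most [eps ^ 2 * B ^ 2 = eps * A / 8], is offset by the linear term
   [- 2 * eps * A / 16]. *)
pose mu := A / 8; pose B : R := 2 * J%:R + 2; pose eps := A / (8 * B ^+ 2).
have J0 : 0 <= J%:R :> R by rewrite ler0n.
have B0 : 0 < B by rewrite /B; lra.
have eps0 : 0 < eps by rewrite divr_gt0 ?mulr_gt0 ?exprn_gt0.
have epsB : eps * B ^+ 2 = A / 8 by rewrite /eps; field; rewrite lt0r_neq0.
have VE z : (1 + (eps%:C)%:P * (geo r J - (mu%:C)%:P)).[z] = 1 + eps%:C * ((geo r J).[z] - mu%:C).
  by move: (geo r J) => G; rewrite !hornerE.
exists (1 + (eps%:C)%:P * (geo r J - (mu%:C)%:P)).
- apply: lt_le_trans (Re_le_normc _); apply: lt_le_trans (ler_norm _).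
  rewrite VE.
  have := geo_Re J rr (ltW a1); set D := normc _ ^+ 2; set g := (geo r J).[a0].
  rewrite ler_norml => /andP[h1 _].
  have D4 : D <= 4.
    have : normc (1 - r%:C * a0) <= 2.
      apply: le_trans (le_normcD _ _) _; rewrite normc1 normcN normcM normcr ger0_norm //.
      by rewrite lerD2l mulr_ile1 // ltW.
    have := normc_ge0 (1 - r%:C * a0); rewrite /D; nra.
  have D0 : 0 <= D by rewrite sqr_ge0.
  have gm : mu < Re g.
    have r2 : r ^+ 2 * normc a0 ^+ 2 <= normc a0 ^+ 2.
      by rewrite -[leRHS]mul1r ler_wpM2r ?sqr_ge0 // exprn_ile1 // ltW.
    rewrite /mu ltNge; apply/negP => hm.
    have : Re g * D <= A / 8 * 4.
      apply: (@le_trans _ _ (A / 8 * D)); first by rewrite ler_wpM2r.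
      by rewrite ler_wpM2l // ltW // divr_gt0.
    by move: h1 r2 tA hJ; rewrite /A; lra.
  have -> : Re (1 + eps%:C * (g - mu%:C)) = 1 + eps * (Re g - mu).
    by case: (g) => x y /=; ring.
  by rewrite ltrDl mulr_gt0 // subr_gt0.
move=> z z1 dz; rewrite VE.
have := geo_Re J rr (eq_ind_r (fun x => x <= 1) (lexx 1) z1).
have := geo_le J rr (eq_ind_r (fun x => x <= 1) (lexx 1) z1).
set g := (geo r J).[z]; rewrite z1 expr1n mulr1 ler_norml => gB /andP[_].
have -> : normc (1 - r%:C * z) ^+ 2 = (1 - r) ^+ 2 + r * normc (z - 1) ^+ 2.
  move: (normc_sqr z); rewrite z1 expr1n !normc_sqr; case: (z) => x y /= h.
  by have y2 : y ^+ 2 = 1 - x ^+ 2; [lra | ring: y2].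
move=> h1.
have dz2 : delta ^+ 2 <= normc (z - 1) ^+ 2 by rewrite lerXn2r ?nnegrE ?normc_ge0 // ltW.
have gm : Re g - mu <= - (A / 16).
  rewrite leNgt; apply/negP => hm.
  have hg : A / 16 < Re g by rewrite /mu in hm; lra.
  have h5 : A / 16 * (3 / 4 * delta ^+ 2) <= Re g * ((1 - r) ^+ 2 + r * normc (z - 1) ^+ 2).
    have [p1 p2] : 0 < 3 / 4 * delta ^+ 2 /\ 0 < A / 16 by split; lra.
    apply: ler_pM; [exact: ltW | exact: ltW | exact: ltW |].
    have rsq := sqr_ge0 (1 - r).
    have h3 (u v w x : R) : 0 <= u -> 0 < v -> v <= w -> 3 / 4 <= x -> 3 / 4 * v <= u + x * w by nra.
    exact: h3.
  have h4 : 1 - r ^+ 2 <= t / 2 by rewrite /r; nra.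
  have Ad : 0 < A * delta ^+ 2 by rewrite mulr_gt0.
  by move: h1 h4 hJ h5 Ad; rewrite /t; lra.
have gB2 : normc (g - mu%:C) <= B.
  apply: le_trans (le_normcD _ _) _; rewrite normcN normcr ger0_norm; last by rewrite ltW // divr_gt0.
  by rewrite /B /mu; lra.
rewrite -(ler_pXn2r (n := 2)) ?nnegrE ?normc_ge0 // expr1n.
have -> : normc (1 + eps%:C * (g - mu%:C)) ^+ 2 = 1 + 2 * eps * (Re g - mu) + eps ^+ 2 * normc (g - mu%:C) ^+ 2.
  by rewrite !normc_sqr; case: (g) => x y /=; ring.
have gB3 : normc (g - mu%:C) ^+ 2 <= B ^+ 2.
  by apply: lerXn2r => //; rewrite nnegrE ?normc_ge0 // ltW.
have h2 : eps ^+ 2 * normc (g - mu%:C) ^+ 2 <= eps * (A / 8).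
  by rewrite -epsB mulrA -expr2 ler_wpM2l ?sqr_ge0.
have h3 : eps * (Re g - mu) <= eps * - (A / 16) by rewrite ler_wpM2l // ltW.
by rewrite -mulrA; lra.
Qed.

Lemma e_surj (x y : R) : x ^+ 2 + y ^+ 2 = 1 -> exists t, e t = x +i* y.
Proof.
move=> h; have [x1 x2] : -1 <= x /\ x <= 1 by split; nra.
have ca : cos (acos x) = x by apply: cos_acos; split; apply/RleP.
have := sin_cos1 (acos x); rewrite ca => s2.
have : (sin (acos x) - y) * (sin (acos x) + y) = 0.
  by rewrite -subr_sqr; apply/eqP; rewrite subr_eq0; apply/eqP; apply: (addIr (x ^+ 2)); rewrite s2 -h addrC.
move=> /eqP; rewrite mulf_eq0 subr_eq0 addr_eq0 => /orP[/eqP E|/eqP E].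
  by exists (acos x); rewrite /e ca E.
by exists (- acos x); rewrite /e cosN sinN ca E opprK.
Qed.

Lemma e_surj_normc (z : C) : normc z = 1 -> exists t, e t = z.
Proof.
case: z => x y h; apply: e_surj.
by have := normc_sqr (x +i* y); rewrite h expr1n.
Qed.

Lemma size_gap_poly n (a b : 'I_n.+1 -> R) : (size (gap_poly a b) <= n.+1)%N.
Proof.
apply/leq_sizeP => j; rewrite leq_eqVlt => /orP[/eqP <-|hj].
  by rewrite coefB !cpoly_coef subrr.
by rewrite coefB !nth_default ?subrr // size_cpoly.
Qed.

Lemma spoly_eq0 n (a : 'I_n -> R) t : spoly a t = 0 -> exists j, e t = e (a j).
Proof.
move/eqP/prodf_eq0 => [j _ /eqP h]; exists j.
by apply/eqP; rewrite -subr_eq0 -normc_eq0 normc_eB h normr0 mulr0.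
Qed.

(** On the circle [|b - a|] is proportional to [|spoly b t * e alpha - spoly a t|], and [e alpha] is
    not real. A zero would thus be a left and a right endpoint at once, against separation. *)
Lemma gap_poly_neq0 n (a b : 'I_n -> R) t0 d alpha t :
  separated a b t0 d -> \sum_j (b j - a j) = 2 * alpha -> 0 < sin alpha ->
  (gap_poly a b).[e t] != 0.
Proof.
move=> S sab sa0; rewrite -normc_eq0 (gap_poly_e _ sab).
apply: mulf_neq0; first by rewrite expf_neq0 // pnatr_eq0.
rewrite normc_eq0; apply/eqP => /eqP; rewrite eq_complex /= => /andP[/eqP h1 /eqP h2].
have sb : spoly b t = 0.
  by apply/eqP; rewrite -(mulIr_eq0 _ (mulIf (lt0r_neq0 sa0))); apply/eqP; move: h2; lra.
have sa : spoly a t = 0 by move: h1; rewrite sb; lra.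
have [j ej] := spoly_eq0 sb; have [i ei] := spoly_eq0 sa.
have := normc_eB (b j) (a i); rewrite -ej ei subrr normc0 => /esym/eqP.
rewrite mulf_eq0 pnatr_eq0 normr_eq0 /=; apply/negP.
have [d0 ab win sep] := S; have abj := ab j.
apply: sin_half_neq0.
  by have [] := @separated_window _ a b t0 d j i (b j) S; rewrite ?(ltW abj) ?lexx.
rewrite subr_eq0; apply/eqP => E.
have [eij|nij] := eqVneq i j; first by subst i; move: abj; rewrite E ltxx.
by have [h|h] := sep i j nij; have := ab i => abi; lra.
Qed.

(** The case [be = 0] encodes a root at infinity and is used when [gap_poly a b] is constant. The
    size of [v1] is one below the bound for [gap_poly a b] in either case, so a factor of degree one
    can be put back. *)
Lemma gap_poly_factor n (a b : 'I_n.+2 -> R) : gap_poly a b != 0 ->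
  exists (v1 : {poly C}) (be ga : C), [/\ (size v1 <= n.+1)%N, (be != 0) || (ga != 0) & gap_poly a b = v1 * (ga%:P - be *: 'X)].
Proof.
move=> v0; have szv := size_gap_poly a b.
have [/size_poly1P[c c0 E]|/closed_rootP[x /factor_theorem[q E]]] := boolP (size (gap_poly a b) == 1%N).
  exists 1, 0, c; rewrite size_poly1 scale0r subr0 mul1r c0 orbT E; split=> //.
exists q, (-1), (- x); split; last by rewrite scaleN1r opprK polyCN addrC.
  have q0 : q != 0 by apply: contraNneq v0 => q0; rewrite E q0 mul0r.
  by move: szv; rewrite E size_Mmonic ?monicXsubC // size_XsubC addn2.
by rewrite oppr_eq0 oner_eq0.
Qed.

Lemma normc_conj (z : C) : normc z^* = normc z.
Proof. by case: z => x y /=; rewrite sqrrN. Qed.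

Lemma normc_mulconj (z : C) : z * z^* = (normc z ^+ 2)%:C.
Proof. by rewrite normc_sqr; case: z => x y; apply/eqP; rewrite eq_complex /=; apply/andP; split; apply/eqP; ring. Qed.

Lemma normc_reflect (be ga : C) t : normc (ga^* * e t - be^*) = normc (ga - be * e t).
Proof.
rewrite -[RHS]normc_conj -[RHS]mul1r -(normc_e t) -normcM; congr (normc _).
rewrite rmorphB rmorphM /= mulrBr [e t * (_ * _)]mulrCA normc_mulconj normc_e expr1n mulr1.
by rewrite mulrC.
Qed.

Lemma size_lin (x y : C) : (size (x%:P * 'X + y%:P)%R <= 2)%N.
Proof. by rewrite size_MXaddC; case: ifP => // _; rewrite ltnS size_polyC; case: eqP. Qed.

Lemma gap_poly_improve n (a b : 'I_n.+2 -> R) t0 d alpha :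
  separated a b t0 d -> \sum_j (b j - a j) = 2 * alpha -> 0 < sin alpha ->
  exists (J : nat) (kap : {poly C}) (rho : R),
    [/\ (0 < J)%N, (size kap <= (n.+1 * J).+1)%N,
     forall t, on_arcs a b t -> normc kap.[e t] <= normc (gap_poly a b).[e t] ^+ J,
     1 < rho & normc kap.[0] = rho * (2 * sin alpha) ^+ J].
Proof.
move=> S sab sa0; have nv0 := gap_poly0 sab; rewrite (gtr0_norm sa0) in nv0.
have v0 : gap_poly a b != 0.
  by apply: contraTneq sa0 => E; move: nv0; rewrite E horner0 normc0; lra.
have [v1 [be [ga [sz1 bg E]]]] := gap_poly_factor v0.
have vE z : (gap_poly a b).[z] = v1.[z] * (ga - be * z) by rewrite E hornerM !hornerE.
have v10 : normc v1.[0] * normc ga = 2 * sin alpha by rewrite -nv0 vE mulr0 subr0 normcM.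
have ga0 : 0 < normc ga.
  rewrite lt_neqAle normc_ge0 andbT eq_sym; apply: contraTneq sa0 => h; move: v10; rewrite h; lra.
have w0 : 0 < normc v1.[0].
  rewrite lt_neqAle normc_ge0 andbT eq_sym; apply: contraTneq sa0 => h; move: v10; rewrite h; lra.
have [hlt|hgt|heq] := ltgtP (normc ga) (normc be).
- exists 1%N, (v1 * ((ga^*)%:P * 'X - (be^*)%:P)), (normc be / normc ga); split=> //.
  + apply: leq_trans (size_polyMleq _ _) _; rewrite muln1 -subn1 leq_subLR add1n.
    have h2 : (size ((ga^*)%:P * 'X - (be^*)%:P : {poly C})%R <= 2)%N by rewrite -polyCN size_lin.
    by rewrite -[X in (_ <= X)%N]addn2 -addn2 leq_add.
  + by move=> t _; rewrite expr1 vE hornerM !hornerE !normcM normc_reflect.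
  + by rewrite ltr_pdivlMr // mul1r.
  + have -> : (v1 * ((ga^*)%:P * 'X - (be^*)%:P)).[0] = v1.[0] * - be^*.
      by rewrite hornerM !hornerE ?mulr0 ?add0r ?sub0r.
    rewrite normcM normcN normc_conj expr1 -v10.
    by field; rewrite lt0r_neq0.
(* The pole of this Moebius map is the chosen root of [b - a], so [(b - a)^J] times a polynomial of
   degree at most [J] in [phi] is again a polynomial. *)
- pose phi z := (ga^* * z - be^*) / (ga - be * z).
  have phi1 t : normc (phi (e t)) = 1.
    rewrite normcM normcV normc_reflect divff //.
    have := gap_poly_neq0 t S sab sa0; rewrite vE mulf_eq0 negb_or normc_eq0 => /andP[_ h].
    by [].
  have [d0 ab win sep] := S.
  (* This comes from [phi z - phi w = (|ga|^2 - |be|^2) (z - w) / ((ga - be z) (ga - be w))]: the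
     chord is at least [2 sin (d / 2)] and each factor of the denominator at most [|ga| + |be|]. *)
  pose delta := 2 * sin (d / 2) * (normc ga ^+ 2 - normc be ^+ 2) / (normc ga + normc be) ^+ 2.
  have den t : 0 < normc (ga - be * e t) <= normc ga + normc be.
    apply/andP; split; last by apply: le_trans (le_normcD _ _) _; rewrite normcN normcM normc_e mulr1.
    rewrite lt_neqAle normc_ge0 andbT eq_sym normc_eq0.
    by have := gap_poly_neq0 t S sab sa0; rewrite vE mulf_eq0 negb_or => /andP[].
  have gb2 : 0 < normc ga ^+ 2 - normc be ^+ 2.
    by have := normc_ge0 be; nra.
  have gb0 : 0 < normc ga + normc be by rewrite ltr_pwDl ?normc_ge0.
  have sd0 : 0 < 2 * sin (d / 2) by rewrite mulr_gt0 // sin_half_pos // (d_lt_pi ord0 S).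
  have delta0 : 0 < delta by apply: divr_gt0; [exact: mulr_gt0 | exact: exprn_gt0].
  have far t : on_arcs a b t -> delta <= normc (phi (e t) / phi (e t0) - 1).
    move=> [j /andP[h1 h2]]; have [w1 w2] := win j.
    have p1 : phi (e t0) != 0 by rewrite -normc_eq0 phi1 oner_eq0.
    have /andP[dt dt'] := den t; have /andP[dt0 dt0'] := den t0.
    have gt : ga - be * e t != 0 by rewrite -normc_eq0 lt0r_neq0.
    have gt0 : ga - be * e t0 != 0 by rewrite -normc_eq0 lt0r_neq0.
    rewrite -[X in _ - X](divff p1) -mulrBl normcM normcV phi1 invr1 mulr1.
    rewrite (_ : phi (e t) - phi (e t0) = (normc ga ^+ 2 - normc be ^+ 2)%:C * (e t - e t0) /
        ((ga - be * e t) * (ga - be * e t0))); last first.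
      by rewrite rmorphB /= -!normc_mulconj /phi; field; rewrite gt gt0.
    rewrite normcM normcV normcM normcr (gtr0_norm gb2) normc_eB normcM.
    have hs : sin (d / 2) <= `|sin ((t - t0) / 2)|.
      apply: le_trans (ler_norm _); apply: sin_half_ge => //; apply/andP; split; lra.
    rewrite /delta; apply: ler_pM.
    - by rewrite ltW // mulr_gt0.
    - by rewrite invr_ge0 exprn_ge0 // ltW.
    - by rewrite mulrC ler_wpM2l ?(ltW gb2) // ler_wpM2l.
    - rewrite lef_pV2 ?posrE ?mulr_gt0 ?exprn_gt0 // expr2.
      by apply: ler_pM => //; exact: ltW.
  have phi0 : normc (phi 0 / phi (e t0)) < 1.
    rewrite normcM normcV phi1 invr1 mulr1 /phi !mulr0 subr0 sub0r normcM normcN normc_conj normcV.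
    by rewrite ltr_pdivrMr // mul1r.
  have [V V1 V2] := peak delta0 phi0; pose G := phi (e t0).
  (* This is [(b - a)^J * V (phi / G)] with denominators cleared and [J = size V]. Dividing by
     [G = phi (e t0)] moves the peak of [V] from [1] to the gap point [e t0]. *)
  pose kap := v1 ^+ size V * \sum_(j < size V) (V`_j / G ^+ j) *:
    (((ga^*)%:P * 'X + (- be^*)%:P) ^+ j * ((- be)%:P * 'X + ga%:P) ^+ (size V - j)).
  have kapE z : ga - be * z != 0 -> kap.[z] = (gap_poly a b).[z] ^+ size V * V.[phi z / G].
    move=> hz; rewrite /kap hornerM horner_exp horner_sum vE exprMn -mulrA; congr (_ * _).
    rewrite horner_coef mulr_sumr; apply: eq_bigr => j _.
    rewrite hornerZ hornerM !horner_exp !hornerD !hornerM !hornerC !hornerX.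
    have -> : - be * z + ga = ga - be * z by rewrite addrC mulNr.
    rewrite -[X in _ = _ ^+ X * _](subnK (ltnW (ltn_ord j))) exprD (exprMn _ (phi z)) exprVn.
    rewrite (_ : ga^* * z + - be^* = phi z * (ga - be * z)); last by rewrite /phi divfK.
    by move: (G ^+ j)^-1 => g; rewrite exprMn; ring.
  have V0 : (0 < size V)%N.
    rewrite lt0n size_poly_eq0; apply: contraTneq V1 => ->.
    by rewrite horner0 normc0 -leNgt ler01.
  exists (size V), kap, (normc V.[phi 0 / G]); split=> //.
  + apply: leq_trans (size_polyMleq _ _) _; rewrite -subn1 leq_subLR add1n.
    have h1 : (size (v1 ^+ size V)%R <= (n * size V).+1)%N by apply: size_exp_le.
    rewrite mulSn addnC -addSn -addnS; apply: leq_add => //.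
    apply: leq_trans (size_sum _ _ _) _; apply/bigmax_leqP => j _.
    apply: leq_trans (size_scale_leq _ _) _; apply: leq_trans (size_polyMleq _ _) _.
    have h2 := size_exp_le j (size_lin (ga^*) (- be^*)).
    have h3 := size_exp_le (size V - j) (size_lin (- be) ga).
    rewrite -subn1 leq_subLR (leq_trans (leq_add h2 h3)) // !mul1n addSn addnS subnKC //.
    exact: ltnW.
  + move=> t ht; have /andP[dt _] := den t.
    rewrite kapE -?normc_eq0 ?lt0r_neq0 // normcM normcX -[leRHS]mulr1.
    rewrite ler_wpM2l ?exprn_ge0 ?normc_ge0 //; apply: V2; last exact: far.
    by rewrite normcM normcV !phi1 divff // oner_eq0.
  + rewrite kapE; last by rewrite mulr0 subr0 -normc_eq0 lt0r_neq0.
    by rewrite normcM normcX nv0 mulrC.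
(* Equal moduli would put the root on the circle, where [b - a] does not vanish. *)
- have be0 : be != 0 by rewrite -normc_eq0 -heq lt0r_neq0.
  have [t et] : exists t, e t = ga / be.
    by apply: e_surj_normc; rewrite normcM normcV -heq divff // lt0r_neq0.
  have := gap_poly_neq0 t S sab sa0.
  by rewrite vE et [be * _]mulrC divfK // subrr mulr0 eqxx.
Qed.

(** The choice [kap = gap_poly a b], [J = 1], [rho = 1] gives the inequality; from two arcs on, the
    improved [kap] leaves a factor [rho ^ (2 m) > 1]. *)
Theorem arcs_bound n (a b : 'I_n -> R) t0 d alpha m (th : 'I_m -> R) (M : R) :
  separated a b t0 d -> \sum_j (b j - a j) = 2 * alpha -> 0 < alpha < PI -> (0 < m)%N ->
  (forall t, on_arcs a b t -> normc (cpoly th).[e t] <= M) ->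
  2 * sin (alpha / 2) ^+ m <= M /\ ((1 < n)%N -> 2 * sin (alpha / 2) ^+ m < M).
Proof.
case: n a b => [|n] a b S sab ha m0 PM.
  by move: sab; rewrite big_ord0 => h; have /andP[? _] := ha; exfalso; lra.
have s0 := sin_half_gt0 ha; have /andP[a0 api] := ha.
have sa0 : 0 < sin alpha by apply/RltP; apply: sin_gt_0; apply/RltP.
have M0 : 0 <= M.
  apply: le_trans (normc_ge0 _) (PM (a ord0) _); exists ord0.
  by have [_ ab _ _] := S; rewrite lexx ltW.
have B0 : 0 < 2 * sin (alpha / 2) ^+ m by apply: mulr_gt0 => //; exact: exprn_gt0.
split.
  rewrite -(ler_pXn2r (n := 2)) ?nnegrE ?(ltW B0) //.
  have h1 : (size (gap_poly a b) <= (n.+1.-1 * 1).+1)%N by rewrite muln1; exact: size_gap_poly.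
  have h2 t : on_arcs a b t -> normc (gap_poly a b).[e t] <= normc (gap_poly a b).[e t] ^+ 1.
    by rewrite expr1.
  have h3 : normc (gap_poly a b).[0] = 1 * (2 * sin alpha) ^+ 1.
    by rewrite (gap_poly0 sab) gtr0_norm // mul1r expr1.
  by have := arcs_bound_improved S sab ha m0 (isT : (0 < 1)%N) h1 h2 ltr01 h3 M0 PM; rewrite expr1n mul1r muln1.
case: n a b S sab PM => // n a b S sab PM _.
have [J [kap [rho [J0 szk kapE rho1 kap0]]]] := gap_poly_improve S sab sa0.
have rho0 : 0 < rho by apply: lt_trans rho1.
have := arcs_bound_improved S sab ha m0 J0 szk kapE rho0 kap0 M0 PM.
have rm : 1 < rho ^+ (2 * m) by rewrite exprn_egt1 ?muln_eq0 -?lt0n ?negb_or //= -lt0n.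
rewrite -(ltr_pXn2r (n := 2 * J)) ?nnegrE ?(ltW B0) ?muln_gt0 //.
apply: lt_le_trans; rewrite -[ltLHS]mul1r ltr_pM2r //.
exact: exprn_gt0.
Qed.

(** With [u = t - c] and [sin (u / 2) = s cos w], the modulus equals [2 s^m |T_m (cos w)|].
    Reversing the order of the zeros and comparing squares turns chords into Chebyshev differences;
    no node is left out here, so both parities are allowed. *)
Lemma cpoly_anode_le m (alpha c t : R) : 0 < alpha < PI -> (0 < m)%N -> c - alpha <= t <= c + alpha ->
  normc (cpoly (fun j : 'I_m => c + anode alpha j)).[e t] <= 2 * sin (alpha / 2) ^+ m.
Proof.
case: m => // m ha _ ht; set s := sin (alpha / 2); have s0 : 0 < s := sin_half_gt0 ha.
have /andP[a0 api] := ha; pose u := t - c; have /andP[u1 u2] : - alpha <= u <= alpha.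
  by rewrite /u; apply/andP; move/andP: ht => [h1 h2]; split; lra.
pose y := sin (u / 2) / s.
have [w yw] : exists w, cos w = y.
  exists (acos y); apply: cos_acos.
  have p0 : 0 < PI by apply: lt_trans api.
  have [b1 b2] : - (PI / 2) <= u / 2 /\ u / 2 <= PI / 2 by split; lra.
  have [b3 b4] : - (PI / 2) <= alpha / 2 /\ alpha / 2 <= PI / 2 by split; lra.
  have [b5 b6] : - (PI / 2) <= - (alpha / 2) /\ - (alpha / 2) <= PI / 2 by split; lra.
  have [b7 b8] : u / 2 <= alpha / 2 /\ - (alpha / 2) <= u / 2 by split; lra.
  have h1 : sin (u / 2) <= s.
    by apply/RleP; apply: sin_incr_1; apply/RleP.
  have h2 : - s <= sin (u / 2).
    by rewrite -sinN; apply/RleP; apply: sin_incr_1; apply/RleP.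
  by split; apply/RleP; [rewrite /y ler_pdivlMr // mulN1r | rewrite /y ler_pdivrMr // mul1r].
have -> : normc (cpoly (fun j : 'I_m.+1 => c + anode alpha j)).[e t] =
    \prod_(j < m.+1) (2 * `|sin ((u - anode alpha j) / 2)|).
  rewrite /cpoly horner_prod normc_prod; apply: eq_bigr => j _.
  by rewrite hornerXsubC normc_eB /u opprD addrA.
set P := \prod_(_ < _) _.
have P2 : P = \prod_(j < m.+1) (2 * `|sin ((u + anode alpha j) / 2)|).
  by rewrite /P (reindex_inj rev_ord_inj) /=; apply: eq_bigr => j _; rewrite anode_rev opprK.
pose W := \prod_(j < m.+1) (2 * s * `|cos w - cos (cnode j)|).
have W2 : W = \prod_(j < m.+1) (2 * s * `|cos w + cos (cnode j)|).
  rewrite /W (reindex_inj rev_ord_inj) /=; apply: eq_bigr => j _.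
  by rewrite cnode_rev cosD cosN sinN cos_PI sin_PI mul0r subr0 mulN1r opprK.
have PW : P ^+ 2 = W ^+ 2.
  rewrite [in LHS]expr2 {2}P2 [in RHS]expr2 {2}W2 /P /W -!big_split; apply: eq_bigr => j _ /=.
  have E : sin (u / 2) = s * cos w by rewrite yw /y [s * _]mulrC divfK // lt0r_neq0.
  transitivity (4 * `|sin ((u - anode alpha j) / 2) * sin ((u + anode alpha j) / 2)|).
    by rewrite normrM; ring.
  have -> : (u - anode alpha j) / 2 = u / 2 - anode alpha j / 2 by field.
  have -> : (u + anode alpha j) / 2 = u / 2 + anode alpha j / 2 by field.
  rewrite !sinD sinN cosN.
  have h1 := sin_cos1 (u / 2); have h2 := sin_cos1 (anode alpha j / 2).
  have Sj := anode_sin j ha; rewrite -/s in Sj.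
  move: (cos (u / 2)) (cos (anode alpha j / 2)) h1 h2; rewrite E Sj => cu ca h1 h2.
  have cu2 : cu ^+ 2 = 1 - (s * cos w) ^+ 2 by lra.
  have ca2 : ca ^+ 2 = 1 - (s * cos (cnode j)) ^+ 2 by lra.
  rewrite (_ : _ * _ = s * s * ((cos w - cos (cnode j)) * (cos w + cos (cnode j)))); last first.
    by ring: cu2 ca2.
  by rewrite !normrM (gtr0_norm s0); ring.
have P0 : 0 <= P by apply: prodr_ge0 => j _; rewrite mulr_ge0.
have W0 : 0 <= W by apply: prodr_ge0 => j _; rewrite !mulr_ge0 // ltW.
have -> : P = W by apply/eqP; rewrite -(eqrXn2 (n := 2)) // PW.
have sm : 0 < s ^+ m.+1 by rewrite exprn_gt0.
rewrite /W big_split /= prodr_const card_ord exprMn exprS.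
have := cheb_prod_le m w; set D := \prod_(_ < _) _ => h.
rewrite (_ : _ * D = 2 * s ^+ m.+1 * (D * 2 ^+ m)); last by ring.
by rewrite -[leRHS]mulr1 ler_wpM2l // mulr_ge0 // ltW.
Qed.

(** * Transfer to lists of points and of intervals *)

Lemma poly_abs_map (s : seq R) t :
  poly_abs [seq cexp x | x <- s] (cexp t) = normc (cpoly (fun j : 'I_(size s) => nth 0 s j)).[e t].
Proof.
rewrite /cpoly horner_prod normc_prod.
under eq_bigr => j _ do rewrite hornerXsubC.
rewrite -(big_mkord xpredT (fun j => normc (e t - e (nth 0 s j)))) -(big_nth 0 xpredT (fun x => normc (e t - e x))).
elim: s => [|x s IH]; first by rewrite big_nil.
rewrite big_cons -IH /= RmultE; congr (_ * _).
by rewrite /cdist RsqrtE !RpowE.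
Qed.

Lemma on_Gamma_cexp (w : pt) : on_Gamma w -> exists t, w = cexp t.
Proof.
case: w => x y; rewrite /on_Gamma /= => h.
have [|t [<- <-]] := @e_surj x y; last by exists t.
by have : x * (x * 1) + y * (y * 1) = 1 :> R := h; rewrite !mulr1 !expr2.
Qed.

Lemma on_Gamma_map (ws : seq pt) : (forall w, List.In w ws -> on_Gamma w) ->
  exists s : seq R, ws = [seq cexp x | x <- s].
Proof.
elim: ws => [|w ws IH] h; first by exists [::].
have [t ->] := on_Gamma_cexp (h w (or_introl erefl)).
have [s ->] := IH (fun x hx => h x (or_intror hx)).
by exists (t :: s).
Qed.

Lemma cover_length_sum (l : seq (R * R)) :
  cover_length l = \sum_(j < size l) ((nth (0, 0) l j).2 - (nth (0, 0) l j).1).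
Proof.
elim: l => [|[a b] l IH]; first by rewrite big_ord0.
by rewrite big_ord_recl /= IH.
Qed.

Lemma e_expn t m : e t ^+ m = e (m%:R * t).
Proof.
elim: m => [|j IH]; first by rewrite mul0r e0.
by rewrite exprS IH -eD -nat1r; congr e; ring.
Qed.

(* [P(z)^2 = P(0) z^m |P(z)|^2] on the unit circle, so a level set of [|P|] consists of roots of a nonzero
   polynomial. *)
Lemma cpoly_level m (th : 'I_m -> R) (M : R) t : normc (cpoly th).[e t] = M ->
  root (cpoly th ^+ 2 - ((M ^+ 2)%:C * (cpoly th).[0]) *: 'X^m) (e t).
Proof.
move=> <-; rewrite /root hornerD hornerN hornerZ hornerXn horner_exp cpoly0 e_expn.
rewrite cpoly_e !normcM normc_e normc_two_i normcr mulr1.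
have -> : (`|spoly th t| * 2 ^+ m) ^+ 2 = (spoly th t * 2 ^+ m) ^+ 2.
  by rewrite !exprMn real_normK ?num_real.
have -> : e ((m%:R * t + \sum_j th j) / 2) = e (m%:R * t / 2) * e ((\sum_j th j) / 2).
  by rewrite -eD; congr e; field.
have [-> ->] : e (m%:R * t) = e (m%:R * t / 2) ^+ 2 /\ e (\sum_j th j) = e ((\sum_j th j) / 2) ^+ 2.
  by rewrite !expr2 -!eD; split; congr e; field.
rewrite !rmorphM !rmorphXn /= subr_eq0; apply/eqP.
have -> : (-1 : C) ^+ m = ('i ^+ m) ^+ 2 by rewrite -exprM mulnC exprM sqr_i.
by rewrite !exprMn; ring.
Qed.

(** A half-open window of length [2 PI] meets each point of the circle once, so finitely many roots
    give finitely many angles. *)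
Lemma angles_of_seq (rs : seq C) t0 : exists L : seq R,
  forall t, t0 <= t < t0 + 2 * PI -> e t \in rs -> List.In t L.
Proof.
elim: rs => [|z rs [L IH]]; first by exists [::].
have [[u /andP[u1 u2] uz]|nz] := Classical_Prop.classic (exists2 u, t0 <= u < t0 + 2 * PI & e u = z).
  exists (u :: L) => t ht; rewrite inE => /orP[/eqP E|h]; last by right; exact: IH.
  left; have [h0|nut] := eqVneq (u - t) 0; first by apply/eqP; rewrite -subr_eq0 h0.
  have /andP[t1 t2] := ht; have bd : - (2 * PI) < u - t < 2 * PI by apply/andP; split; lra.
  have := normc_eB u t; rewrite uz E subrr normc0 => /esym/eqP.
  by rewrite mulf_eq0 pnatr_eq0 normr_eq0 /= (negbTE (sin_half_neq0 bd nut)).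
exists L => t ht; rewrite inE => /orP[/eqP E|h]; last exact: IH.
by case: nz; exists t.
Qed.

Lemma In_nth_ord (l : seq (R * R)) i : (i < size l)%N -> List.In (nth (0, 0) l i) l.
Proof. by elim: l i => // p l IH [|i] /= hi; [left | right; exact: IH]. Qed.

Lemma ForallOrdPairs_nth (P : R * R -> R * R -> Prop) (l : seq (R * R)) i j :
  List.ForallOrdPairs P l -> (i < j < size l)%N -> P (nth (0, 0) l i) (nth (0, 0) l j).
Proof.
move=> H; elim: H i j => [|p l' Hp _ IH] i j; first by rewrite andbF.
case: i j => [|i] [|j] //= hij; last exact: IH.
by move/List.Forall_forall: Hp; apply; exact: In_nth_ord.
Qed.

Local Open Scope R_scope.

Lemma arcs_bound_list (l : list (R * R)) (t0 d alpha M : R) (ws : list pt) (m : nat) :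
  0 < d ->
  (forall p, List.In p l -> fst p < snd p /\ t0 + d <= fst p /\ snd p <= t0 + 2 * PI - d) ->
  List.ForallOrdPairs (fun p q => snd p + d <= fst q \/ snd q + d <= fst p) l ->
  cover_length l = 2 * alpha -> 0 < alpha < PI -> in_Pm m ws -> Peano.le 1 m ->
  (forall t p, List.In p l -> fst p <= t <= snd p -> poly_abs ws (cexp t) <= M) ->
  2 * sin (alpha / 2) ^ m <= M /\ (Peano.le 2 (length l) -> 2 * sin (alpha / 2) ^ m < M).
Proof.
move=> d0 inl sep len [a0 api] [<- onw] m1 hM.
have [s E] := on_Gamma_map onw.
pose a (j : 'I_(size l)) := fst (nth (0, 0)%R l j); pose b (j : 'I_(size l)) := snd (nth (0, 0)%R l j).
have S : separated a b t0 d.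
  split.
  - exact/RltP.
  - by move=> j; have [/RltP h _] := inl _ (In_nth_ord (ltn_ord j)).
  - by move=> j; have [_ [/RleP h1 /RleP h2]] := inl _ (In_nth_ord (ltn_ord j)).
  - move=> i j nij; have : (i < j)%N || (j < i)%N by rewrite -neq_ltn.
    case/orP => hij.
      by have [|/RleP h|/RleP h] := ForallOrdPairs_nth (i := i) (j := j) sep; rewrite ?hij ?ltn_ord //; [left|right].
    by have [|/RleP h|/RleP h] := ForallOrdPairs_nth (i := j) (j := i) sep; rewrite ?hij ?ltn_ord //; [right|left].
have sab : (\sum_j (b j - a j) = 2 * alpha)%R by rewrite -cover_length_sum len.
have ha : (0 < alpha < PI)%R by apply/andP; split; apply/RltP.
have sz : size ws = size s by rewrite E size_map.
have m0 : (0 < size s)%N by rewrite -sz; apply/ssrnat.leP.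
have PM t : on_arcs a b t -> (normc (cpoly (fun j : 'I_(size s) => nth 0%R s j)).[e t] <= M)%R.
  move=> [j /andP[/RleP h1 /RleP h2]]; rewrite -poly_abs_map -E; apply/RleP.
  by apply: (hM t (nth (0, 0)%R l j)); [exact: In_nth_ord | split].
have [h1 h2] := arcs_bound S sab ha m0 PM.
rewrite RpowE -[length ws]/(size ws) sz; split; first exact/RleP.
by move=> /ssrnat.leP hl; apply/RltP; exact: h2.
Qed.

Lemma arc_zeros (m : nat) (alpha c : R) : 0 < alpha < PI -> Peano.le 1 m ->
  exists ws, in_Pm m ws /\
    forall t, c - alpha <= t <= c + alpha -> poly_abs ws (cexp t) <= 2 * sin (alpha / 2) ^ m.
Proof.
move=> [a0 api] /ssrnat.leP m0.
have ha : (0 < alpha < PI)%R by apply/andP; split; apply/RltP.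
pose th (j : 'I_m) : R := (c + anode alpha j)%R.
pose s := [seq th j | j <- enum 'I_m]; have ss : size s = m by rewrite size_map size_enum_ord.
exists [seq cexp x | x <- s]; split.
  split; first by rewrite -[length _]/(size _) size_map.
  elim: s {ss} => [|x s IH] w //= [<-|/IH//].
  by rewrite /on_Gamma /cexp /= !Rmult_1_r Rplus_comm; exact: sin2_cos2.
move=> t [h1 h2]; rewrite poly_abs_map RpowE; apply/RleP.
have ht : (c - alpha <= t <= c + alpha)%R by apply/andP; split; apply/RleP.
have := cpoly_anode_le ha m0 ht; congr (_ <= _)%R.
rewrite /cpoly !horner_prod !normc_prod -(big_mkord xpredT (fun j => normc ('X - (e (nth 0%R s j))%:P).[e t])) ss.
rewrite big_mkord; apply: eq_bigr => j _; congr (normc ('X - (e _)%:P).[_]).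
by rewrite (nth_map j) ?size_enum_ord // nth_ord_enum.
Qed.

Lemma level_finite (m : nat) (ws : list pt) (t0 M : R) : in_Pm m ws -> Peano.le 1 m ->
  exists L : list R, forall t, t0 <= t < t0 + 2 * PI -> poly_abs ws (cexp t) = M -> List.In t L.
Proof.
move=> [<- onw] /ssrnat.leP m0; have [s E] := on_Gamma_map onw.
pose th (j : 'I_(size s)) := nth 0%R s j.
pose D := (cpoly th ^+ 2 - ((M ^+ 2)%:C * (cpoly th).[0]) *: 'X^(size s))%R.
(* At [0] the term with [X^m] vanishes, and [|P(0)| = 1]. *)
have D0 : D != 0%R.
  apply/negP => /eqP D0; have : D.[0%R] = 0%R by rewrite D0 horner0.
  have m1 : (0 < size s)%N by move: m0; rewrite E -[length _]/(size _) size_map.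
  rewrite /D hornerD hornerN hornerZ hornerXn horner_exp expr0n eqn0Ngt m1 /= mulr0 subr0.
  move=> /eqP; rewrite expf_eq0 /= -normc_eq0 cpoly0 normcM normcX normcN normc1 expr1n normc_e mulr1.
  by rewrite oner_eq0.
have [rs DE] := closed_field_poly_normal D.
have [L hL] := angles_of_seq rs t0.
exists L => t [/RleP t1 /RltP t2] ft; apply: hL; first by apply/andP.
have := @cpoly_level _ th M t; rewrite -poly_abs_map -E ft => /(_ erefl).
by rewrite -/D DE rootZ ?lead_coef_eq0 // root_prod_XsubC.
Qed.

End CircleAlgebra.

(** * Measure and sublevel sets *)

Definition pabs (ws : list pt) (t : R) : R := poly_abs ws (cexp t).

Lemma cover_length_app (l1 l2 : list (R * R)) :
  cover_length (l1 ++ l2) = cover_length l1 + cover_length l2.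
Proof.
  induction l1 as [|[a b] l1 IH]; simpl; [lra | rewrite IH; lra].
Qed.

Lemma cexp_period t : cexp (t + 2 * PI) = cexp t.
Proof.
  unfold cexp. rewrite sin_plus, cos_plus, sin_2PI, cos_2PI. f_equal; ring.
Qed.

Lemma on_Gamma_angle z : on_Gamma z -> exists t, - PI <= t <= PI /\ z = cexp t.
Proof.
  destruct z as [x y]; unfold on_Gamma, cexp; simpl; intros h.
  assert (hx : -1 <= x <= 1) by nra.
  destruct (acos_bound x) as [b1 b2].
  assert (hs : sqrt (1 - x²) * sqrt (1 - x²) = y * y).
  { rewrite sqrt_sqrt; unfold Rsqr; nra. }
  assert (h0 := sqrt_pos (1 - x²)).
  destruct (Rle_dec 0 y).
  - exists (acos x). split; [lra|]. rewrite cos_acos, sin_acos by exact hx. f_equal. nra.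
  - exists (- acos x). split; [lra|]. rewrite cos_neg, sin_neg, cos_acos, sin_acos by exact hx.
    f_equal. nra.
Qed.

Lemma on_Gamma_window z t0 : on_Gamma z -> 0 <= t0 <= 2 * PI ->
  exists t, t0 <= t <= t0 + 2 * PI /\ z = cexp t.
Proof.
  intros hz ht0. destruct (on_Gamma_angle z hz) as [t [ht ->]]. assert (hp := PI_RGT_0).
  destruct (Rle_dec t0 t) as [h|h]; [exists t; split; [lra | reflexivity]|].
  destruct (Rle_dec t0 (t + 2 * PI)) as [h2|h2].
  - exists (t + 2 * PI). rewrite cexp_period. split; [lra | reflexivity].
  - exists (t + 2 * PI + 2 * PI). rewrite !cexp_period. split; [lra | reflexivity].
Qed.

(* An interval of the window [t0, t0 + 2 PI] is cut at [2 PI] and its right part moved back by a period. *)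
Lemma arc_measure_le Q mu t0 (l : list (R * R)) :
  arc_measure Q mu -> 0 <= t0 <= 2 * PI -> (forall p, In p l -> fst p <= snd p) ->
  (forall t, t0 <= t <= t0 + 2 * PI -> Q (cexp t) -> exists p, In p l /\ fst p <= t <= snd p) ->
  mu <= cover_length l.
Proof.
  intros [hmu _] ht0 hl hcov. assert (hpi := PI_RGT_0).
  apply Rnot_lt_le; intros hlt.
  set (n := INR (length l)). assert (hn : 0 <= n) by apply pos_INR.
  (* Each interval yields two pieces widened by [eps] on both sides, hence [4 * eps] of extra length
     per interval, which in total stays below the assumed defect. *)
  set (eps := (mu - cover_length l) / (4 * (n + 1))).
  assert (heps : 0 < eps) by (apply Rdiv_lt_0_compat; lra).
  set (g := fun p : R * R => [(Rmin (fst p) (2 * PI) - eps, Rmin (snd p) (2 * PI) + eps);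
    (Rmax (fst p) (2 * PI) - 2 * PI - eps, Rmax (snd p) (2 * PI) - 2 * PI + eps)]).
  assert (hlen : forall l', cover_length (flat_map g l') = cover_length l' + 4 * eps * INR (length l')).
  { clearbody eps. intros l'. induction l' as [|[a b] l' IH]; [simpl; lra|].
    change (flat_map g ((a, b) :: l')) with (g (a, b) ++ flat_map g l').
    rewrite cover_length_app, IH. simpl length. rewrite S_INR. simpl.
    unfold Rmin, Rmax; repeat destruct Rle_dec; lra. }
  assert (hm : mu <= cover_length (flat_map g l)).
  { apply hmu. exists (flat_map g l). split; [|reflexivity]. split.
    - intros q hq. apply in_flat_map in hq. destruct hq as [p [hp hq]].
      specialize (hl p hp). simpl in hq.
      destruct hq as [<-|[<-|[]]]; simpl; unfold Rmin, Rmax; repeat destruct Rle_dec; lra.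
    - intros t [ht hQ]. destruct (Rle_dec t0 t) as [h|h].
      + destruct (hcov t ltac:(lra) hQ) as [p [hp hpt]].
        exists (Rmin (fst p) (2 * PI) - eps, Rmin (snd p) (2 * PI) + eps). split.
        * apply in_flat_map. exists p. simpl; auto.
        * simpl. unfold Rmin; repeat destruct Rle_dec; lra.
      + rewrite <- cexp_period in hQ.
        destruct (hcov (t + 2 * PI) ltac:(lra) hQ) as [p [hp hpt]].
        exists (Rmax (fst p) (2 * PI) - 2 * PI - eps, Rmax (snd p) (2 * PI) - 2 * PI + eps). split.
        * apply in_flat_map. exists p. simpl; auto.
        * simpl. unfold Rmax; repeat destruct Rle_dec; lra. }
  rewrite hlen in hm. fold n in hm.
  assert (h4 : 4 * eps * (n + 1) = mu - cover_length l) by (unfold eps; field; lra).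
  nra.
Qed.

Lemma cdist_cexp_sqr t u : cdist (cexp t) (cexp u) ^ 2 = 2 * (1 - cos (t - u)).
Proof.
  unfold cdist, cexp; simpl fst; simpl snd. rewrite pow2_sqrt by (apply Rplus_le_le_0_compat; apply pow2_ge_0).
  rewrite cos_minus. assert (h1 := sin2_cos2 t). assert (h2 := sin2_cos2 u). unfold Rsqr in *. nra.
Qed.

Lemma cdist_nonneg z w : 0 <= cdist z w.
Proof. apply sqrt_pos. Qed.

Lemma poly_abs_nonneg ws z : 0 <= poly_abs ws z.
Proof.
  induction ws as [|w ws IH]; simpl; [lra|]. apply Rmult_le_pos; [apply cdist_nonneg | exact IH].
Qed.

Lemma continuity_pabs ws : continuity (pabs ws).
Proof.
  induction ws as [|w ws IH].
  - apply continuity_const. intros x y; reflexivity.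
  - change (continuity (mult_fct (fun t => cdist (cexp t) w) (pabs ws))).
    apply continuity_mult; [|exact IH].
    intros t. apply (continuity_pt_comp (fun t => (cos t - fst w) ^ 2 + (sin t - snd w) ^ 2) sqrt).
    + reg.
    + apply continuity_pt_sqrt. apply Rplus_le_le_0_compat; apply pow2_ge_0.
Qed.

(* Midpoint log-concavity of a single chord length, from
   (1 - cos (a - x)) (1 - cos (a + x)) = (cos x - cos a)^2. *)
Lemma cdist_midpoint w r : on_Gamma w -> 0 < cdist (cexp r) w ->
  exists d, 0 < d /\ forall x, 0 < x < d ->
    cdist (cexp (r - x)) w * cdist (cexp (r + x)) w < cdist (cexp r) w ^ 2.
Proof.
  intros hw h0. destruct (on_Gamma_angle w hw) as [u [_ ->]].
  assert (hC := cdist_cexp_sqr r u). set (C := cdist (cexp r) (cexp u)) in *.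
  set (a := r - u) in *. assert (ha : cos a < 1) by nra.
  (* This bound on [x] gives [2 cos a - 1 < cos x < 1], that is [|cos x - cos a| < 1 - cos a]. *)
  exists (Rmin 1 (2 * (1 - cos a))). split; [apply Rmin_glb_lt; lra|].
  intros x [hx hxd].
  assert (hx1 := Rlt_le_trans _ _ _ hxd (Rmin_l _ _)).
  assert (hx2 := Rlt_le_trans _ _ _ hxd (Rmin_r _ _)).
  assert (hA := cdist_cexp_sqr (r - x) u). assert (hB := cdist_cexp_sqr (r + x) u).
  assert (hA0 := cdist_nonneg (cexp (r - x)) (cexp u)).
  assert (hB0 := cdist_nonneg (cexp (r + x)) (cexp u)).
  set (A := cdist (cexp (r - x)) (cexp u)) in *. set (B := cdist (cexp (r + x)) (cexp u)) in *.
  replace (r - x - u) with (a - x) in hA by (unfold a; ring).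
  replace (r + x - u) with (a + x) in hB by (unfold a; ring).
  rewrite cos_minus in hA. rewrite cos_plus in hB.
  assert (e1 := sin2_cos2 a). assert (e2 := sin2_cos2 x). unfold Rsqr in e1, e2.
  assert (hAB : (A * B) ^ 2 = (2 * (cos x - cos a)) ^ 2).
  { rewrite Rpow_mult_distr, hA, hB.
    transitivity (4 * ((1 - cos a * cos x) ^ 2 - (sin a * sin a) * (sin x * sin x))); [ring|].
    replace (sin a * sin a) with (1 - cos a * cos a) by lra.
    replace (sin x * sin x) with (1 - cos x * cos x) by lra. ring. }
  assert (hs : 0 < sin (x / 2) < x / 2).
  { split; [apply sin_gt_0; assert (h3 := PI2_1); lra | apply sin_lt_x; lra]. }
  assert (hc : cos x = 1 - 2 * sin (x / 2) * sin (x / 2)).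
  { replace x with (2 * (x / 2)) at 1 by field. apply cos_2a_sin. }
  assert (hc1 : cos x < 1) by nra.
  assert (hc2 : 2 * cos a - 1 < cos x) by nra.
  rewrite hC. apply Rnot_le_lt. intros hle. nra.
Qed.

Lemma pabs_midpoint ws r : (forall w, In w ws -> on_Gamma w) -> (1 <= length ws)%nat -> 0 < pabs ws r ->
  exists d, 0 < d /\ forall x, 0 < x < d -> pabs ws (r - x) * pabs ws (r + x) < pabs ws r ^ 2.
Proof.
  intros hws hlen hpos. destruct ws as [|w ws]; [simpl in hlen; lia|]. clear hlen.
  revert w hws hpos. induction ws as [|w' ws IH]; intros w hws hpos.
  - unfold pabs in *; simpl poly_abs in *.
    destruct (cdist_midpoint w r (hws w (or_introl eq_refl)) ltac:(lra)) as [d [hd h]].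
    exists d. split; [exact hd|]. intros x hx. specialize (h x hx). lra.
  - assert (hn := cdist_nonneg (cexp r) w).
    assert (hn' := poly_abs_nonneg (w' :: ws) (cexp r)).
    unfold pabs in hpos. change (poly_abs (w :: w' :: ws) (cexp r))
      with (cdist (cexp r) w * poly_abs (w' :: ws) (cexp r)) in hpos.
    assert (h1 : 0 < cdist (cexp r) w) by nra.
    assert (h2 : 0 < poly_abs (w' :: ws) (cexp r)) by nra.
    destruct (cdist_midpoint w r (hws w (or_introl eq_refl)) h1) as [d1 [hd1 g1]].
    destruct (IH w' (fun v hv => hws v (or_intror hv)) h2) as [d2 [hd2 g2]].
    exists (Rmin d1 d2). split; [apply Rmin_glb_lt; assumption|].
    intros x [hx hxd].
    specialize (g1 x (conj hx (Rlt_le_trans _ _ _ hxd (Rmin_l _ _)))).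
    specialize (g2 x (conj hx (Rlt_le_trans _ _ _ hxd (Rmin_r _ _)))).
    unfold pabs in *.
    change (poly_abs (w :: w' :: ws)) with (fun z => cdist z w * poly_abs (w' :: ws) z). cbv beta.
    assert (a1 := cdist_nonneg (cexp (r - x)) w). assert (a2 := cdist_nonneg (cexp (r + x)) w).
    assert (b1 := poly_abs_nonneg (w' :: ws) (cexp (r - x))).
    assert (b2 := poly_abs_nonneg (w' :: ws) (cexp (r + x))).
    set (A := cdist (cexp (r - x)) w) in *. set (B := cdist (cexp (r + x)) w) in *.
    set (A' := poly_abs (w' :: ws) (cexp (r - x))) in *.
    set (B' := poly_abs (w' :: ws) (cexp (r + x))) in *.
    replace (A * A' * (B * B')) with ((A * B) * (A' * B')) by ring.
    rewrite Rpow_mult_distr.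
    apply Rle_lt_trans with ((A * B) * poly_abs (w' :: ws) (cexp r) ^ 2).
    + apply Rmult_le_compat_l; [apply Rmult_le_pos; assumption | lra].
    + apply Rmult_lt_compat_r; [apply pow_lt; exact h2 | exact g1].
Qed.

(** By the midpoint inequality one of two symmetric neighbours lies strictly below. Hence a point
    with [|P| = M > 0] is a limit of points with [|P| < M], and the sublevel set has no isolated
    points at that level. *)
Lemma below_near_level ws r eps : (forall w, In w ws -> on_Gamma w) -> (1 <= length ws)%nat ->
  0 < pabs ws r -> 0 < eps -> exists t, Rabs (t - r) < eps /\ pabs ws t < pabs ws r.
Proof.
  intros hws hlen hpos heps. destruct (pabs_midpoint ws r hws hlen hpos) as [d [hd h]].
  assert (hx : 0 < Rmin d eps / 2) by (assert (0 < Rmin d eps) by (apply Rmin_glb_lt; lra); lra).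
  assert (hx1 := Rmin_l d eps). assert (hx2 := Rmin_r d eps).
  remember (Rmin d eps / 2) as x eqn:hxe. assert (hxd : 0 < x < d) by lra.
  specialize (h x hxd). destruct (Rlt_le_dec (pabs ws (r - x)) (pabs ws r)) as [h1|h1].
  - exists (r - x). split; [rewrite Rabs_left; lra | exact h1].
  - exists (r + x). split; [rewrite Rabs_right; lra|]. nra.
Qed.

Lemma continuity_le_limit (f : R -> R) (M c d : R) (x : R) :
  continuity f -> c < d -> (forall t, c < t < d -> f t <= M) -> c <= x <= d -> f x <= M.
Proof.
  intros hf hcd h hx. apply Rnot_lt_le; intros hlt.
  destruct (hf x (f x - M) ltac:(lra)) as [al [hal hal2]]. simpl in hal2. unfold R_dist in hal2.
  assert (exists t, c < t < d /\ Rabs (t - x) < al) as [t [ht1 ht2]].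
  { destruct (Rle_lt_dec x ((c + d) / 2)).
    - exists (x + Rmin al (d - c) / 3).
      assert (0 < Rmin al (d - c)) by (apply Rmin_glb_lt; lra).
      assert (h1 := Rmin_l al (d - c)). assert (h2 := Rmin_r al (d - c)).
      split; [lra | rewrite Rabs_right; lra].
    - exists (x - Rmin al (d - c) / 3).
      assert (0 < Rmin al (d - c)) by (apply Rmin_glb_lt; lra).
      assert (h1 := Rmin_l al (d - c)). assert (h2 := Rmin_r al (d - c)).
      split; [lra | rewrite Rabs_left; lra]. }
  destruct (Req_dec t x) as [e|ne]; [subst t; specialize (h x ht1); lra|].
  assert (hd := hal2 t (conj (conj I (fun e => ne (eq_sym e))) ht2)).
  specialize (h t ht1). apply Rabs_def2 in hd. lra.
Qed.

(** Induction on the number of candidate level points in [L]: cut at a level point, or, if none lies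
    inside, let the intermediate value theorem fix the side of [M]. Neighbouring intervals may share
    an endpoint, and points with [f t = M] may remain uncovered. *)
Lemma sublevel_intervals (f : R -> R) (M : R) (L : list R) (c d : R) :
  continuity f -> c < d -> (forall t, c < t < d -> f t = M -> In t L) ->
  exists l : list (R * R),
    (forall p, In p l -> c <= fst p /\ fst p < snd p /\ snd p <= d /\
       forall t, fst p <= t <= snd p -> f t <= M) /\
    (forall t, c <= t <= d -> f t < M -> exists p, In p l /\ fst p <= t <= snd p).
Proof.
  intros hf. remember (length L) as n eqn:hn. revert L hn c d.
  induction n as [n IH] using (well_founded_induction PeanoNat.Nat.lt_wf_0). intros L hn c d hcd hL.
  destruct (classic (exists r, c < r < d /\ f r = M)) as [[r [hr hfr]]|hno].
  - assert (hin := hL r hr hfr). apply in_split in hin. destruct hin as [L1 [L2 ->]].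
    rewrite length_app in hn; simpl in hn.
    assert (hlt : (length (L1 ++ L2) < n)%nat) by (rewrite length_app; lia).
    assert (hL' : forall t, c < t < d -> t <> r -> f t = M -> In t (L1 ++ L2)).
    { intros t ht hne hft. specialize (hL t ht hft). apply in_app_or in hL. apply in_or_app.
      destruct hL as [?|[?|?]]; [left; assumption | congruence | right; assumption]. }
    destruct (IH _ hlt (L1 ++ L2) eq_refl c r ltac:(lra)) as [l1 [h1 g1]].
    { intros t ht. apply hL'; lra. }
    destruct (IH _ hlt (L1 ++ L2) eq_refl r d ltac:(lra)) as [l2 [h2 g2]].
    { intros t ht. apply hL'; lra. }
    exists (l1 ++ l2). split.
    + intros p hp. apply in_app_or in hp. destruct hp as [hp|hp].
      * destruct (h1 p hp) as [? [? [? ?]]]. repeat split; try lra; assumption.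
      * destruct (h2 p hp) as [? [? [? ?]]]. repeat split; try lra; assumption.
    + intros t ht hft. destruct (Rle_dec t r) as [h|h].
      * destruct (g1 t ltac:(lra) hft) as [p [hp hpt]]. exists p. split; [apply in_or_app; auto | exact hpt].
      * destruct (g2 t ltac:(lra) hft) as [p [hp hpt]]. exists p. split; [apply in_or_app; auto | exact hpt].
  - assert (hsame : forall x y, c < x < d -> c < y < d -> f x < M -> M < f y -> False).
    { intros x y hx hy hfx hfy. apply hno.
      destruct (IVT_cor (fun t => f t - M) (Rmin x y) (Rmax x y)) as [z [hz hfz]].
      - apply continuity_minus; [exact hf | apply continuity_const; intros ? ?; reflexivity].
      - apply Rle_trans with x; [apply Rmin_l | apply Rmax_l].
      - unfold Rmin, Rmax. destruct (Rle_dec x y); nra.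
      - exists z. split; [|lra]. unfold Rmin, Rmax in hz. destruct (Rle_dec x y); lra. }
    assert (hmid : c < (c + d) / 2 < d) by lra.
    destruct (Rtotal_order (f ((c + d) / 2)) M) as [hl|[he|hg]].
    + exists [(c, d)]. split.
      * intros p [<-|[]]. simpl. repeat split; try lra. intros t ht.
        apply (continuity_le_limit f M c d t hf hcd); [|exact ht].
        intros s hs. apply Rnot_lt_le. intros h. exact (hsame _ _ hmid hs hl h).
      * intros t ht _. exists (c, d). split; [left; reflexivity | exact ht].
    + exfalso. apply hno. eauto.
    + exists []. split; [intros p []|]. intros t ht hft. exfalso.
      assert (hge : - f t <= - M).
      { apply (continuity_le_limit (fun s => - f s) (- M) c d t); [|exact hcd| |exact ht].
        - apply continuity_opp. exact hf.
        - intros s hs. assert (~ f s < M); [|lra]. intros h. exact (hsame _ _ hs hmid h hg). }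
      lra.
Qed.

Definition apart (d : R) (p q : R * R) : Prop := snd p + d <= fst q \/ snd q + d <= fst p.

Definition disjoint (p q : R * R) : Prop := snd p < fst q \/ snd q < fst p.

Lemma ForallOrdPairs_split (A : Type) (P : A -> A -> Prop) (l : list A) :
  (forall l1 p l2 q l3, l = l1 ++ p :: l2 ++ q :: l3 -> P p q) -> ForallOrdPairs P l.
Proof.
  induction l as [|a l IH]; intros h; constructor.
  - apply Forall_forall. intros q hq. apply in_split in hq. destruct hq as [l2 [l3 ->]].
    exact (h [] a l2 q l3 eq_refl).
  - apply IH. intros l1 p l2 q l3 ->. exact (h (a :: l1) p l2 q l3 eq_refl).
Qed.

Lemma ForallOrdPairs_impl (A : Type) (P Q : A -> A -> Prop) (l : list A) :
  (forall p q, P p q -> Q p q) -> ForallOrdPairs P l -> ForallOrdPairs Q l.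
Proof.
  intros h H. induction H as [|a l ha _ IH]; constructor; [|exact IH].
  eapply Forall_impl; [|exact ha]. intros q. apply h.
Qed.

Lemma ForallOrdPairs_map (A : Type) (P Q : A -> A -> Prop) (g : A -> A) (l : list A) :
  (forall p q, In p l -> In q l -> P p q -> Q (g p) (g q)) -> ForallOrdPairs P l -> ForallOrdPairs Q (map g l).
Proof.
  intros h H. induction H as [|a l ha _ IH]; simpl; constructor.
  - apply Forall_forall. intros q hq. apply in_map_iff in hq. destruct hq as [x [<- hx]].
    apply h; simpl; auto. rewrite Forall_forall in ha. auto.
  - apply IH. intros p q hp hq. apply h; simpl; auto.
Qed.

Lemma margin (l : list (R * R)) (c e : R) :
  (forall p, In p l -> c < fst p /\ snd p < e) -> ForallOrdPairs disjoint l ->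
  exists d, 0 < d /\ (forall p, In p l -> c + d <= fst p /\ snd p <= e - d) /\ ForallOrdPairs (apart d) l.
Proof.
  intros hl H. induction H as [|a l ha _ IH].
  - exists 1. split; [lra|]. split; [intros p []|constructor].
  - destruct IH as [d [hd [hin hop]]]; [intros p hp; apply hl; simpl; auto|].
    assert (exists d', 0 < d' /\ Forall (apart d' a) l) as [d' [hd' hF]].
    { clear -ha. induction ha as [|q l hq _ [d' [hd' hF]]].
      - exists 1. split; [lra | constructor].
      - assert (exists x, 0 < x /\ apart x a q) as [x [hx hxq]].
        { destruct hq as [hq|hq]; [exists (fst q - snd a) | exists (fst a - snd q)]; unfold apart; split; lra. }
        exists (Rmin d' x). split; [apply Rmin_glb_lt; lra|]. constructor.
        + assert (h := Rmin_r d' x). unfold apart in *. lra.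
        + eapply Forall_impl; [|exact hF]. intros y. assert (h := Rmin_l d' x). unfold apart. lra. }
    destruct (hl a (or_introl eq_refl)) as [h1 h2].
    set (x := Rmin d (Rmin d' (Rmin (fst a - c) (e - snd a)))).
    assert (x <= d) by apply Rmin_l.
    assert (x <= d') by (eapply Rle_trans; [apply Rmin_r | apply Rmin_l]).
    assert (x <= fst a - c) by (do 2 (eapply Rle_trans; [apply Rmin_r|]); apply Rmin_l).
    assert (x <= e - snd a) by (do 2 (eapply Rle_trans; [apply Rmin_r|]); apply Rmin_r).
    exists x. split; [repeat apply Rmin_glb_lt; lra|]. split.
    + intros p [<-|hp]; [lra|]. specialize (hin p hp). lra.
    + constructor.
      * eapply Forall_impl; [|exact hF]. intros y. unfold apart. lra.
      * eapply ForallOrdPairs_impl; [|exact hop]. intros p q. unfold apart. lra.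
Qed.

Lemma cover_length_shrink (lam : R) (l : list (R * R)) :
  cover_length (map (fun p => (fst p, fst p + lam * (snd p - fst p))) l) = lam * cover_length l.
Proof. induction l as [|[a b] l IH]; simpl; [ring | rewrite IH; ring]. Qed.

(** The Blaschke product needs total length exactly [2 alpha]. Shrinking every arc towards its left
    endpoint by one ratio achieves this and keeps the number of arcs and the bound on [|P|];
    disjoint closed arcs also acquire a uniform margin. *)
Lemma arcs_lower_bound (l : list (R * R)) (t0 alpha M : R) (ws : list pt) (m : nat) :
  (forall p, In p l -> t0 < fst p /\ fst p < snd p /\ snd p < t0 + 2 * PI /\
     forall t, fst p <= t <= snd p -> pabs ws t <= M) ->
  ForallOrdPairs disjoint l -> 2 * alpha <= cover_length l -> 0 < alpha < PI -> in_Pm m ws -> (1 <= m)%nat ->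
  2 * sin (alpha / 2) ^ m <= M /\ ((2 <= length l)%nat -> 2 * sin (alpha / 2) ^ m < M).
Proof.
  intros hl hop hlen ha hws hm.
  set (lam := 2 * alpha / cover_length l).
  assert (hlam : 0 < lam) by (apply Rdiv_lt_0_compat; lra).
  assert (hlam1 : lam * cover_length l = 2 * alpha) by (unfold lam; field; lra).
  assert (hlam2 : lam <= 1) by nra.
  set (g := fun p : R * R => (fst p, fst p + lam * (snd p - fst p))).
  assert (hg : forall p, In p l -> fst p < snd (g p) <= snd p).
  { intros p hp. destruct (hl p hp) as [_ [h _]]. simpl. split; nra. }
  destruct (margin (map g l) t0 (t0 + 2 * PI)) as [d [hd [hin hap]]].
  { intros q hq. apply in_map_iff in hq. destruct hq as [p [<- hp]].
    specialize (hg p hp). destruct (hl p hp) as [h1 [_ [h2 _]]]. simpl fst. lra. }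
  { apply (ForallOrdPairs_map _ disjoint); [|exact hop]. intros p q hp hq.
    assert (h1 := hg p hp). assert (h2 := hg q hq). unfold disjoint. simpl fst. lra. }
  assert (hres := @CircleAlgebra.arcs_bound_list (map g l) t0 d alpha M ws m hd).
  rewrite length_map in hres. apply hres; clear hres; try assumption.
  - intros q hq. destruct (hin q hq). apply in_map_iff in hq. destruct hq as [p [<- hp]].
    specialize (hg p hp). simpl fst in *. lra.
  - unfold g. rewrite cover_length_shrink. exact hlam1.
  - intros t q hq ht. apply in_map_iff in hq. destruct hq as [p [<- hp]].
    specialize (hg p hp). destruct (hl p hp) as [_ [_ [_ h]]]. apply h. simpl fst in ht. lra.
Qed.

Definition sublevel_family (f : R -> R) (M c d : R) (l : list (R * R)) : Prop :=
  (forall p, In p l -> c <= fst p /\ fst p < snd p /\ snd p <= d /\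
     forall t, fst p <= t <= snd p -> f t <= M) /\
  (forall t, c <= t <= d -> f t < M -> exists p, In p l /\ fst p <= t <= snd p).

(* A family of minimal cardinality is disjoint: two meeting intervals could be merged. *)
Lemma disjoint_sublevel_family (f : R -> R) (M c d : R) :
  (exists l, sublevel_family f M c d l) ->
  exists l, sublevel_family f M c d l /\ ForallOrdPairs disjoint l.
Proof.
  intros [l hl]. remember (length l) as n eqn:hn. revert l hn hl.
  induction n as [n IH] using (well_founded_induction PeanoNat.Nat.lt_wf_0). intros l hn hl.
  destruct (classic (ForallOrdPairs disjoint l)) as [h|h]; [eauto|].
  assert (exists l1 p l2 q l3, l = l1 ++ p :: l2 ++ q :: l3 /\ ~ disjoint p q) as (l1 & p & l2 & q & l3 & -> & hpq).
  { apply NNPP. intros hno. apply h. apply ForallOrdPairs_split. intros l1 p l2 q l3 e.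
    apply NNPP. intros hd. apply hno. exists l1, p, l2, q, l3. auto. }
  assert (hin : forall x, In x (l1 ++ p :: l2 ++ q :: l3) <-> x = p \/ x = q \/ In x (l1 ++ l2 ++ l3)).
  { intros x. rewrite !in_app_iff. simpl. rewrite !in_app_iff. simpl. intuition. }
  rewrite !length_app in hn; simpl in hn; rewrite length_app in hn; simpl in hn.
  set (r := (Rmin (fst p) (fst q), Rmax (snd p) (snd q))).
  destruct hl as [hA hB].
  assert (hp := hA p (proj2 (hin p) (or_introl eq_refl))).
  assert (hq := hA q (proj2 (hin q) (or_intror (or_introl eq_refl)))).
  destruct hp as (p1 & p2 & p3 & p4). destruct hq as (q1 & q2 & q3 & q4).
  assert (hm : forall t, fst r <= t <= snd r <-> (fst p <= t <= snd p \/ fst q <= t <= snd q)).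
  { intros t. unfold disjoint in hpq. unfold r, Rmin, Rmax; simpl. repeat destruct Rle_dec; lra. }
  apply (IH (length (r :: l1 ++ l2 ++ l3))) with (l := r :: l1 ++ l2 ++ l3); [|reflexivity|].
  { simpl. rewrite !length_app. lia. }
  split.
  - intros x [<-|hx]; [|apply hA; apply hin; auto].
    unfold r at 1 2 3 4; simpl. repeat split.
    + apply Rmin_glb; assumption.
    + unfold Rmin, Rmax; repeat destruct Rle_dec; lra.
    + apply Rmax_lub; assumption.
    + intros t ht. apply hm in ht. destruct ht; auto.
  - intros t ht hft. destruct (hB t ht hft) as [x [hx hxt]]. apply hin in hx.
    destruct hx as [->|[->|hx]].
    + exists r. split; [left; reflexivity | apply hm; auto].
    + exists r. split; [left; reflexivity | apply hm; auto].
    + exists x. split; [right; exact hx | exact hxt].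
Qed.

Lemma Un_cv_inv_bound (u : nat -> R) (l : R) :
  (forall n, Rabs (u n - l) < / INR (S n)) -> Un_cv u l.
Proof.
  intros h eps heps. destruct (archimed_cor1 eps heps) as [N [hN hN0]].
  exists N. intros n hn. unfold Rdist. apply Rlt_trans with (/ INR (S n)); [apply h|].
  apply Rle_lt_trans with (/ INR N); [|exact hN].
  apply Rinv_le_contravar; [apply lt_0_INR; lia | apply le_INR; lia].
Qed.

Lemma closed_set_angle (Q : pt -> Prop) (t1 : R) : Defs.closed_set Q -> ~ Q (cexp t1) ->
  exists eps, 0 < eps /\ forall t, Rabs (t - t1) < eps -> ~ Q (cexp t).
Proof.
  intros hc hQ. apply NNPP. intros hno.
  assert (forall n : nat, exists t, Rabs (t - t1) < / INR (S n) /\ Q (cexp t)) as hex.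
  { intros n. apply NNPP. intros hn. apply hno. exists (/ INR (S n)).
    split; [apply Rinv_0_lt_compat; apply lt_0_INR; lia|].
    intros t ht hq. apply hn. eauto. }
  apply choice in hex. destruct hex as [u hu]. apply hQ.
  apply (hc (fun n => cexp (u n))); [intros n; apply hu|].
  assert (hcv : Un_cv u t1) by (apply Un_cv_inv_bound; intros n; apply hu).
  split; simpl; apply continuity_seq; try exact hcv; [apply continuity_cos | apply continuity_sin].
Qed.

Lemma pow_lt_mono (x y : R) (m : nat) : 0 <= x < y -> (1 <= m)%nat -> x ^ m < y ^ m.
Proof.
  intros hxy hm. destruct m as [|m]; [lia|]. clear hm. induction m as [|m IH]; simpl in *; [lra|].
  assert (0 <= x * x ^ m) by (change (0 <= x ^ S m); apply pow_le; lra).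
  apply Rmult_le_0_lt_compat; lra.
Qed.

Lemma sin_half_pow_lt (x y : R) (m : nat) : 0 < x < y -> y < PI -> (1 <= m)%nat ->
  sin (x / 2) ^ m < sin (y / 2) ^ m.
Proof.
  intros hx hy hm. apply pow_lt_mono; [|exact hm]. split.
  - apply Rlt_le, sin_gt_0; lra.
  - apply sin_increasing_1; lra.
Qed.

Lemma arcs_eq_or_above (Q : pt -> Prop) (alpha M : R) (ws : list pt) (m : nat) :
  admissible Q (2 * alpha) -> 0 < alpha < PI -> in_Pm m ws -> (1 <= m)%nat -> 0 < M ->
  (forall z, Q z -> poly_abs ws z <= M) ->
  2 * sin (alpha / 2) ^ m <= M /\ (M = 2 * sin (alpha / 2) ^ m -> is_arc Q (2 * alpha)).
Proof.
  intros [[hclosed _] [hG hmu]] ha hws hm hM hQ. assert (hpi := PI_RGT_0).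
  destruct (classic (exists t0, 0 <= t0 <= 2 * PI /\ M < pabs ws t0)) as [[t0 [ht0 hft0]]|hall].
  2: {
    (* If [|P| <= M] on the whole circle, the bound for an arc of the larger half-length
       [(alpha + PI) / 2] already makes the inequality strict. *)
    assert (hlow : 2 * sin ((alpha + PI) / 2 / 2) ^ m <= M).
    { apply (arcs_lower_bound [(PI - (alpha + PI) / 2, PI + (alpha + PI) / 2)] 0 _ M ws m).
      - intros p [<-|[]]. simpl. repeat split; try lra. intros t ht.
        apply Rnot_lt_le. intros h. apply hall. exists t. split; [lra | exact h].
      - constructor; constructor.
      - simpl. lra.
      - lra.
      - exact hws.
      - exact hm. }
    assert (h := sin_half_pow_lt alpha ((alpha + PI) / 2) m ltac:(lra) ltac:(lra) hm).
    split; [lra | intros ->; lra]. }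
  set (c := t0) in *. set (d := t0 + 2 * PI).
  assert (hfd : M < pabs ws d) by (unfold pabs, d; rewrite cexp_period; exact hft0).
  destruct (@CircleAlgebra.level_finite m ws t0 M hws hm) as [L hL].
  destruct (disjoint_sublevel_family (pabs ws) M c d) as [l [[hl hcov] hdis]].
  { apply (sublevel_intervals (pabs ws) M L c d (continuity_pabs ws)); [unfold d, c; lra|].
    intros t ht. apply hL. unfold c, d in ht. lra. }
  assert (hin : forall p, In p l -> c < fst p /\ fst p < snd p /\ snd p < d /\
     forall t, fst p <= t <= snd p -> pabs ws t <= M).
  { intros p hp. destruct (hl p hp) as (h1 & h2 & h3 & h4). repeat split; try assumption.
    - destruct h1 as [h1|h1]; [exact h1|]. exfalso. specialize (h4 (fst p) ltac:(lra)).
      rewrite <- h1 in h4. lra.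
    - destruct h3 as [h3|h3]; [exact h3|]. exfalso. specialize (h4 (snd p) ltac:(lra)).
      rewrite h3 in h4. lra. }
  (* A finite union of closed intervals contains its limit points; through [below_near_level] it
     therefore also contains the points where [|P| = M]. *)
  assert (hcl : forall t, (forall eps, 0 < eps -> exists u, Rabs (u - t) < eps /\
      exists p, In p l /\ fst p <= u <= snd p) -> exists p, In p l /\ fst p <= t <= snd p).
  { intros t. clear. induction l as [|p l IH]; intros h.
    - destruct (h 1 ltac:(lra)) as [u [_ [p [[] _]]]].
    - destruct (classic (fst p <= t <= snd p)) as [hp|hp]; [exists p; simpl; auto|].
      destruct IH as [q [hq hqt]]; [|exists q; simpl; auto].
      intros eps heps.
      assert (exists e, 0 < e /\ forall u, Rabs (u - t) < e -> ~ (fst p <= u <= snd p)) as [e [he hne]].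
      { destruct (Rlt_le_dec t (fst p)) as [h1|h1].
        - exists (fst p - t). split; [lra|]. intros u hu. apply Rabs_def2 in hu. lra.
        - exists (t - snd p). split; [lra|]. intros u hu. apply Rabs_def2 in hu. lra. }
      destruct (h (Rmin eps e)) as [u [hu [q [[<-|hq] hqu]]]].
      + apply Rmin_glb_lt; assumption.
      + exfalso. apply (hne u); [|exact hqu]. assert (h2 := Rmin_r eps e). lra.
      + exists u. split; [assert (h2 := Rmin_l eps e); lra | exists q; auto]. }
  assert (hsub : forall t, c <= t <= d -> pabs ws t <= M -> exists p, In p l /\ fst p <= t <= snd p).
  { intros t ht hft. destruct hft as [hft|hft]; [apply hcov; assumption|].
    assert (c < t < d).
    { split; [destruct (proj1 ht) as [?|e] | destruct (proj2 ht) as [?|e]]; try assumption; exfalso.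
      - rewrite <- e in hft; lra.
      - rewrite e in hft; lra. }
    apply hcl. intros eps heps.
    destruct (below_near_level ws t (Rmin eps (Rmin (t - c) (d - t)))) as [u [hu hfu]].
    - exact (proj2 hws).
    - destruct hws as [<- _]. exact hm.
    - lra.
    - repeat apply Rmin_glb_lt; lra.
    - assert (h1 := Rmin_l eps (Rmin (t - c) (d - t))). assert (h2 := Rmin_r eps (Rmin (t - c) (d - t))).
      assert (h3 := Rmin_l (t - c) (d - t)). assert (h4 := Rmin_r (t - c) (d - t)).
      exists u. split; [lra|]. apply hcov; [|lra]. apply Rabs_def2 in hu. lra. }
  assert (hlen : 2 * alpha <= cover_length l).
  { apply (arc_measure_le Q (2 * alpha) t0 l hmu ht0).
    - intros p hp. destruct (hin p hp). lra.
    - intros t ht hq. apply hsub; [unfold c, d; lra | apply hQ; exact hq]. }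
  destruct (arcs_lower_bound l t0 alpha M ws m hin hdis hlen ha hws hm) as [hle hlt].
  split; [exact hle|]. intros hMe.
  destruct l as [|[a b] [|q l]].
  - simpl in hlen. lra.
  - simpl in hlen. destruct (hin (a, b) (or_introl eq_refl)) as (h1 & h2 & h3 & h4). simpl in h1, h2, h3, h4.
    (* A longer arc would satisfy the bound of its own length, which is larger than [M]. *)
    assert (hab : b - a = 2 * alpha).
    { destruct (Rle_lt_dec (b - a) (2 * alpha)) as [h|h]; [lra|]. exfalso.
      assert (h5 : 2 * sin ((b - a) / 2 / 2) ^ m <= M).
      { apply (arcs_lower_bound [(a, b)] t0 _ M ws m); try assumption.
        - simpl. lra.
        - unfold c, d in *. lra. }
      assert (h6 := sin_half_pow_lt alpha ((b - a) / 2) m ltac:(lra) ltac:(unfold c, d in *; lra) hm). lra. }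
    exists a. rewrite <- hab. intros z. split.
    + intros hz. destruct (on_Gamma_window z t0 (hG z hz) ht0) as [t [ht ->]].
      destruct (hsub t) as [p [[<-|[]] hp]]; [unfold c, d; lra | apply hQ; exact hz|].
      exists t. simpl in hp. split; [lra | reflexivity].
    (* A point of the arc outside the closed set [Q] has a neighbourhood that misses [Q], and the
       two remaining pieces are too short for the measure of [Q]. *)
    + intros [t [ht ->]]. apply NNPP. intros hnq.
      destruct (closed_set_angle Q t hclosed hnq) as [eps [heps hne]].
      assert (hlow : 2 * alpha <= cover_length [(a, Rmax a (t - eps)); (Rmin b (t + eps), b)]).
      { apply (arc_measure_le Q (2 * alpha) t0 _ hmu ht0).
        - intros p [<-|[<-|[]]]; simpl; [apply Rmax_l | apply Rmin_l].
        - intros u hu hq. destruct (hsub u) as [p [[<-|[]] hp]]; [unfold c, d; lra | apply hQ; exact hq|].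
          simpl in hp. destruct (Rle_lt_dec u (t - eps)) as [g|g].
          + exists (a, Rmax a (t - eps)). split; [simpl; auto|]. simpl. split; [lra|].
            apply Rle_trans with (t - eps); [exact g | apply Rmax_r].
          + destruct (Rle_lt_dec (t + eps) u) as [g'|g'].
            * exists (Rmin b (t + eps), b). split; [simpl; auto|]. simpl. split; [|lra].
              apply Rle_trans with (t + eps); [apply Rmin_r | exact g'].
            * exfalso. apply (hne u); [|exact hq]. apply Rabs_def1; lra. }
      simpl in hlow. revert hlow. unfold Rmax, Rmin. repeat destruct Rle_dec; lra.
  - exfalso. assert (h := hlt ltac:(simpl; lia)). lra.
Qed.

(** * Extremal polynomials *)

(** The map [phi] need not be increasing; [n <= phi n] is enough to pass limits along it. *)
Lemma bounded_seq_cluster (u : nat -> R) (a b : R) : (forall n, a <= u n <= b) ->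
  exists (phi : nat -> nat) (l : R), (forall n, (n <= phi n)%nat) /\ Un_cv (fun n => u (phi n)) l.
Proof.
  intros hu.
  destruct (Bolzano_Weierstrass u (fun c => a <= c <= b) (compact_P3 a b) hu) as [l hl].
  assert (forall n : nat, exists p, (n <= p)%nat /\ Rabs (u p - l) < / INR (S n)) as hex.
  { intros n. assert (hpos : 0 < / INR (S n)) by (apply Rinv_0_lt_compat, lt_0_INR; lia).
    apply (hl (fun x => Rabs (x - l) < / INR (S n)) n).
    exists (mkposreal _ hpos). intros x hx. exact hx. }
  apply choice in hex. destruct hex as [phi hphi]. exists phi, l. split; [intros n; apply hphi|].
  apply Un_cv_inv_bound. intros n. apply hphi.
Qed.

Lemma Un_cv_subseq (u : nat -> R) (phi : nat -> nat) (l : R) :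
  (forall n, (n <= phi n)%nat) -> Un_cv u l -> Un_cv (fun n => u (phi n)) l.
Proof.
  intros hphi hu eps heps. destruct (hu eps heps) as [N hN]. exists N. intros n hn.
  apply hN. specialize (hphi n). lia.
Qed.

Lemma on_Gamma_cexp t : on_Gamma (cexp t).
Proof. unfold on_Gamma, cexp; simpl. assert (h := sin2_cos2 t). unfold Rsqr in h. lra. Qed.

Lemma continuity_cdist_cexp z : continuity (fun t => cdist z (cexp t)).
Proof.
  intros t. apply (continuity_pt_comp (fun t => (fst z - cos t) ^ 2 + (snd z - sin t) ^ 2) sqrt).
  - reg.
  - apply continuity_pt_sqrt. apply Rplus_le_le_0_compat; apply pow2_ge_0.
Qed.

(** The zeros are made convergent one at a time through their angles. Pointwise convergence of [|P|]
    is all that is kept, because an upper bound at each point of [Q] passes to the limit. *)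
Lemma in_Pm_compact (m : nat) (u : nat -> list pt) : (forall n, in_Pm m (u n)) ->
  exists (phi : nat -> nat) (ws : list pt), (forall n, (n <= phi n)%nat) /\ in_Pm m ws /\
    forall z, Un_cv (fun n => poly_abs (u (phi n)) z) (poly_abs ws z).
Proof.
  revert u. induction m as [|m IH]; intros u hu.
  - exists (fun n => n), []. split; [intros n; lia|]. split; [split; [reflexivity | intros w []]|].
    intros z eps heps. exists 0%nat. intros n _. destruct (hu n) as [h _].
    apply length_zero_iff_nil in h. rewrite h. simpl. rewrite Rdist_eq. exact heps.
  - assert (forall n, exists p : R * list pt, u n = cexp (fst p) :: snd p /\ - PI <= fst p <= PI) as hex.
    { intros n. destruct (hu n) as [h1 h2]. destruct (u n) as [|w l]; [discriminate|].
      destruct (on_Gamma_angle w (h2 w (or_introl eq_refl))) as [t [ht ->]].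
      exists (t, l). split; [reflexivity | exact ht]. }
    apply choice in hex. destruct hex as [p hp].
    destruct (bounded_seq_cluster (fun n => fst (p n)) (- PI) PI) as [phi [t [hphi ht]]];
      [intros n; apply hp|].
    destruct (IH (fun n => snd (p (phi n)))) as [psi [ws [hpsi [hws hcv]]]].
    { intros n. destruct (hu (phi n)) as [h1 h2]. rewrite (proj1 (hp (phi n))) in h1, h2.
      split; [simpl in h1; lia | intros w hw; apply h2; right; exact hw]. }
    exists (fun n => phi (psi n)), (cexp t :: ws). split; [|split].
    + intros n. specialize (hphi (psi n)). specialize (hpsi n). lia.
    + destruct hws as [h1 h2]. split; [simpl; lia|]. intros w [<-|hw]; [apply on_Gamma_cexp | auto].
    + intros z.
      assert (hmul : Un_cv (fun n => cdist z (cexp (fst (p (phi (psi n))))) * poly_abs (snd (p (phi (psi n)))) z)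
        (cdist z (cexp t) * poly_abs ws z)).
      { apply CV_mult; [|apply hcv].
        apply (continuity_seq (fun t => cdist z (cexp t)) (fun n => fst (p (phi (psi n)))) t).
        - apply continuity_cdist_cexp.
        - exact (Un_cv_subseq (fun n => fst (p (phi n))) psi t hpsi ht). }
      intros eps heps. destruct (hmul eps heps) as [N hN]. exists N. intros n hn.
      rewrite (proj1 (hp (phi (psi n)))). apply hN. exact hn.
Qed.

Lemma cdist_le_2 z w : on_Gamma z -> on_Gamma w -> cdist z w <= 2.
Proof.
  intros hz hw. destruct (on_Gamma_angle z hz) as [t [_ ->]]. destruct (on_Gamma_angle w hw) as [u [_ ->]].
  assert (h := cdist_cexp_sqr t u). assert (h0 := cdist_nonneg (cexp t) (cexp u)).
  destruct (COS_bound (t - u)). nra.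
Qed.

Lemma poly_abs_le_pow ws z : on_Gamma z -> (forall w, In w ws -> on_Gamma w) ->
  poly_abs ws z <= 2 ^ length ws.
Proof.
  intros hz. induction ws as [|w ws IH]; intros hws; simpl; [lra|].
  apply Rmult_le_compat; [apply cdist_nonneg | apply poly_abs_nonneg | |].
  - apply cdist_le_2; [exact hz | apply hws; left; reflexivity].
  - apply IH. intros v hv. apply hws. right; exact hv.
Qed.

Lemma admissible_inhabited Q l : admissible Q l -> 0 < l -> exists z, Q z.
Proof.
  intros [_ [_ hmu]] hl. apply NNPP. intros hno. assert (hpi := PI_RGT_0).
  assert (h : l <= cover_length []); [|simpl in h; lra].
  apply (arc_measure_le Q l 0 [] hmu); [lra | intros p [] |].
  intros t _ hq. exfalso. eauto.
Qed.

Lemma sup_norm_exists Q l m ws : admissible Q l -> 0 < l -> in_Pm m ws -> exists M, is_sup_norm Q ws M.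
Proof.
  intros hQ hl [_ hws]. destruct (admissible_inhabited Q l hQ hl) as [z hz].
  destruct (completeness (fun v => exists z, Q z /\ v = poly_abs ws z)) as [M hM].
  - exists (2 ^ length ws). intros v [x [hx ->]]. apply poly_abs_le_pow; [apply hQ; exact hx | exact hws].
  - eauto.
  - exists M. exact hM.
Qed.

Lemma sup_norm_ge Q alpha m ws M : admissible Q (2 * alpha) -> 0 < alpha < PI -> (1 <= m)%nat ->
  in_Pm m ws -> is_sup_norm Q ws M -> 2 * sin (alpha / 2) ^ m <= M.
Proof.
  intros hQ ha hm hws [hM _].
  destruct (admissible_inhabited Q _ hQ ltac:(lra)) as [z hz].
  assert (h0 : 0 <= M).
  { apply Rle_trans with (poly_abs ws z); [apply poly_abs_nonneg | apply hM; eauto]. }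
  apply Rnot_lt_le; intros hlt.
  (* The value [M = 0] is not yet excluded, so the lower bound is applied to the midpoint, which is
     positive and still too small. *)
  destruct (arcs_eq_or_above Q alpha ((M + 2 * sin (alpha / 2) ^ m) / 2) ws m hQ ha hws hm) as [h _].
  - lra.
  - intros x hx. apply Rle_trans with M; [apply hM; eauto | lra].
  - lra.
Qed.

Lemma glb_exists (S : R -> Prop) (b : R) : (exists x, S x) -> (forall x, S x -> b <= x) ->
  exists g, is_glb S g.
Proof.
  intros [x hx] hb. destruct (completeness (fun y => S (- y))) as [g [hg1 hg2]].
  - exists (- b). intros y hy. specialize (hb _ hy). lra.
  - exists (- x). rewrite Ropp_involutive. exact hx.
  - exists (- g). split.
    + intros y hy. assert (h : - y <= g) by (apply hg1; rewrite Ropp_involutive; exact hy). lra.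
    + intros c hc. assert (h : g <= - c); [|lra]. apply hg2. intros y hy. specialize (hc _ hy). lra.
Qed.

Lemma glb_unique (S : R -> Prop) (g h : R) : is_glb S g -> is_glb S h -> g = h.
Proof. intros [a b] [c d]. apply Rle_antisym; auto. Qed.

(* Compactness of the configurations of zeros turns the infimum into a minimum. *)
Lemma minimizer_exists Q m e : is_Em m Q e ->
  exists ws, in_Pm m ws /\ forall z, Q z -> poly_abs ws z <= e.
Proof.
  intros [_ hglb].
  assert (forall n, exists ws, in_Pm m ws /\ forall z, Q z -> poly_abs ws z <= e + / INR (S n)) as hex.
  { intros n. assert (hpos : 0 < / INR (S n)) by (apply Rinv_0_lt_compat, lt_0_INR; lia).
    apply NNPP. intros hno. assert (h : e + / INR (S n) <= e); [|lra]. apply hglb.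
    intros v [ws [hws [hub _]]]. apply Rnot_lt_le. intros hlt. apply hno. exists ws. split; [exact hws|].
    intros z hz. apply Rle_trans with v; [apply hub; eauto | lra]. }
  apply choice in hex. destruct hex as [u hu].
  destruct (in_Pm_compact m u) as [phi [ws [hphi [hws hcv]]]]; [intros n; apply hu|].
  exists ws. split; [exact hws|]. intros z hz. apply Rnot_lt_le. intros hlt.
  destruct (hcv z ((poly_abs ws z - e) / 2) ltac:(lra)) as [N hN].
  destruct (archimed_cor1 ((poly_abs ws z - e) / 2) ltac:(lra)) as [N' [hN' hN0]].
  set (n := (N + N')%nat). specialize (hN n ltac:(unfold n; lia)). unfold Rdist in hN.
  apply Rabs_def2 in hN. assert (h := proj2 (hu (phi n)) z hz).
  assert (hinv : / INR (S (phi n)) <= / INR N').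
  { apply Rinv_le_contravar; [apply lt_0_INR; lia|]. apply le_INR. specialize (hphi n). unfold n in *. lia. }
  lra.
Qed.

(** The interval [(a, b)] containing the right endpoint [y] is removed. Being open, it misses its
    left endpoint [a], so the others cover [[x, a]] and induction on their number applies. *)
Lemma interval_cover_length (c : list (R * R)) (x y : R) :
  (forall p, In p c -> fst p < snd p) -> x <= y ->
  (forall t, x <= t <= y -> exists p, In p c /\ fst p < t < snd p) -> y - x <= cover_length c.
Proof.
  remember (length c) as n eqn:hn. revert c hn y.
  induction n as [|n IH]; intros c hn y hc hxy hcov;
    destruct (hcov y ltac:(lra)) as [[a b] [hp hyp]]; simpl in hyp;
    apply in_split in hp; destruct hp as [c1 [c2 ->]]; rewrite length_app in hn; simpl in hn; [lia|].
  assert (hc' : forall p, In p (c1 ++ c2) -> fst p < snd p).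
  { intros p hp. apply hc. apply in_app_iff. apply in_app_iff in hp. simpl. tauto. }
  assert (hlen : cover_length (c1 ++ (a, b) :: c2) = b - a + cover_length (c1 ++ c2)).
  { rewrite !cover_length_app. simpl. ring. }
  rewrite hlen. destruct (Rlt_le_dec a x) as [h|h].
  - assert (0 <= cover_length (c1 ++ c2)); [|lra]. clear -hc'. induction (c1 ++ c2) as [|[p q] l IHl]; simpl; [lra|].
    assert (h := hc' (p, q) (or_introl eq_refl)). simpl in h.
    assert (0 <= cover_length l) by (apply IHl; intros r hr; apply hc'; right; exact hr). lra.
  - assert (a - x <= cover_length (c1 ++ c2)); [|lra]. apply IH; [rewrite length_app; lia | exact hc' | exact h|].
    intros t ht. destruct (hcov t ltac:(lra)) as [p [hp hpt]]. apply in_app_iff in hp.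
    destruct hp as [hp|[<-|hp]]; [|simpl in hpt; lra|]; exists p; rewrite in_app_iff; auto.
Qed.

Lemma cos_le_arc alpha t : 0 < alpha < PI -> 0 <= t <= 2 * PI ->
  (cos t <= - cos alpha <-> PI - alpha <= t <= PI + alpha).
Proof.
  intros ha ht.
  assert (e1 : - cos alpha = cos (PI - alpha)) by (rewrite cos_minus, cos_PI, sin_PI; ring).
  assert (e2 : cos t = cos (2 * PI - t)) by (rewrite cos_minus, cos_2PI, sin_2PI; ring).
  rewrite e1. split.
  - intros h. split; apply Rnot_lt_le; intros hlt.
    + assert (cos (PI - alpha) < cos t) by (apply cos_decreasing_1; lra). lra.
    + assert (cos (PI - alpha) < cos (2 * PI - t)) by (apply cos_decreasing_1; lra). lra.
  - intros h. destruct (Rle_dec t PI).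
    + apply cos_decr_1; lra.
    + rewrite e2. apply cos_decr_1; lra.
Qed.

(** The arc is centred at [-1], away from the cut at angle [0], so its angles in [[0, 2 PI]] form
    one interval. Its description by coordinates reduces closedness to limits of coordinates. *)
Lemma arc_admissible alpha : 0 < alpha < PI -> exists Q, admissible Q (2 * alpha) /\ is_arc Q (2 * alpha).
Proof.
  intros ha. assert (hpi := PI_RGT_0).
  exists (fun z => on_Gamma z /\ fst z <= - cos alpha). split.
  - split; [split|split].
    + intros u p hu [hc1 hc2].
      assert (hsq := CV_plus _ _ _ _ (CV_mult _ _ _ _ hc1 hc1) (CV_mult _ _ _ _ hc2 hc2)).
      split.
      * unfold on_Gamma. apply (UL_sequence (fun _ => 1)).
        -- intros eps heps. destruct (hsq eps heps) as [N hN]. exists N. intros n hn.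
           specialize (hN n hn). destruct (hu n) as [g _]. unfold on_Gamma in g.
           replace (fst (u n) * fst (u n) + snd (u n) * snd (u n)) with 1 in hN by (rewrite <- g; ring).
           replace (fst p ^ 2 + snd p ^ 2) with (fst p * fst p + snd p * snd p) by ring. exact hN.
        -- intros eps heps. exists 0%nat. intros n _. rewrite Rdist_eq. exact heps.
      * apply Rnot_lt_le. intros hlt. destruct (hc1 (fst p + cos alpha) ltac:(lra)) as [N hN].
        specialize (hN N (le_n N)). unfold Rdist in hN. apply Rabs_def2 in hN.
        destruct (hu N) as [_ g]. lra.
    + exists 1. intros z [hz _]. unfold cdist. simpl fst; simpl snd. unfold on_Gamma in hz.
      rewrite !Rminus_0_r, hz, sqrt_1. lra.
    + intros z [hz _]. exact hz.
    + split.
      * intros x [c [[hc1 hc2] ->]].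
        replace (2 * alpha) with (PI + alpha - (PI - alpha)) by ring.
        apply interval_cover_length; [exact hc1 | lra|].
        intros t ht. apply hc2. split; [lra|]. split; [apply on_Gamma_cexp|].
        apply cos_le_arc; [exact ha | lra | exact ht].
      * intros b hb. apply Rnot_lt_le. intros hlt.
        assert (h : b <= cover_length [(PI - alpha - (b - 2 * alpha) / 4, PI + alpha + (b - 2 * alpha) / 4)]).
        { apply hb. eexists. split; [|reflexivity]. split.
          - intros p [<-|[]]. simpl. lra.
          - intros t [ht [_ hq]]. eexists. split; [left; reflexivity|].
            apply cos_le_arc in hq; [|exact ha | exact ht]. simpl. lra. }
        simpl in h. lra.
  - exists (PI - alpha). intros z. split.
    + intros [hz hf]. destruct (on_Gamma_window z 0 hz ltac:(lra)) as [t [ht ->]].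
      exists t. split; [|reflexivity]. simpl in hf. apply cos_le_arc in hf; lra.
    + intros [t [ht ->]]. split; [apply on_Gamma_cexp|]. apply cos_le_arc; lra.
Qed.

Lemma arc_Em_le Q alpha m e : 0 < alpha < PI -> (1 <= m)%nat -> admissible Q (2 * alpha) ->
  is_arc Q (2 * alpha) -> is_Em m Q e -> e <= 2 * sin (alpha / 2) ^ m.
Proof.
  intros ha hm hQ [t0 hall] [hlow _].
  destruct (@CircleAlgebra.arc_zeros m alpha (t0 + alpha) ha hm) as [ws [hws hle]].
  destruct (sup_norm_exists Q _ m ws hQ ltac:(lra) hws) as [M hM].
  apply Rle_trans with M; [apply hlow; eauto|].
  apply hM. intros v [z [hz ->]]. apply hall in hz. destruct hz as [t [ht ->]]. apply hle. lra.
Qed.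

Theorem theorem7 (m : nat) (alpha : R) :
  (1 <= m)%nat -> 0 < alpha < PI ->
  (forall Q : pt -> Prop, admissible Q (2 * alpha) ->
     exists e, is_Em m Q e /\
       e >= 2 * (sin (alpha / 2)) ^ m /\
       (e = 2 * (sin (alpha / 2)) ^ m <-> is_arc Q (2 * alpha)))
  /\ is_Em_len m (2 * alpha) (2 * (sin (alpha / 2)) ^ m).
Proof.
  intros hm ha.
  assert (hB : 0 < 2 * sin (alpha / 2) ^ m).
  { apply Rmult_lt_0_compat; [lra|]. apply pow_lt, sin_gt_0; lra. }
  assert (main : forall Q : pt -> Prop, admissible Q (2 * alpha) ->
     exists e, is_Em m Q e /\ e >= 2 * (sin (alpha / 2)) ^ m /\
       (e = 2 * (sin (alpha / 2)) ^ m <-> is_arc Q (2 * alpha))).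
  { intros Q hQ.
    assert (hlow : forall v, (exists ws, in_Pm m ws /\ is_sup_norm Q ws v) -> 2 * sin (alpha / 2) ^ m <= v).
    { intros v [ws [hws hv]]. exact (sup_norm_ge Q alpha m ws v hQ ha hm hws hv). }
    destruct (glb_exists (fun v => exists ws, in_Pm m ws /\ is_sup_norm Q ws v) (2 * sin (alpha / 2) ^ m))
      as [e he]; [|exact hlow|].
    { destruct (@CircleAlgebra.arc_zeros m alpha 0 ha hm) as [ws [hws _]].
      destruct (sup_norm_exists Q (2 * alpha) m ws hQ ltac:(lra) hws) as [M hM]. eauto. }
    assert (hge : 2 * sin (alpha / 2) ^ m <= e) by (apply he; exact hlow).
    exists e. split; [exact he|]. split; [lra|]. split.
    - intros ->. destruct (minimizer_exists Q m _ he) as [ws [hws hle]].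
      exact (proj2 (arcs_eq_or_above Q alpha _ ws m hQ ha hws hm hB hle) eq_refl).
    - intros harc. apply Rle_antisym; [|exact hge]. exact (arc_Em_le Q alpha m e ha hm hQ harc he). }
  split; [exact main|]. split.
  - intros v [Q [hQ hv]]. destruct (main Q hQ) as [e [he [hge _]]].
    rewrite (glb_unique _ _ _ hv he). lra.
  (* An arc attains the bound, so the bound itself belongs to the set whose infimum is taken. *)
  - intros b hb. destruct (arc_admissible alpha ha) as [Q [hQ harc]].
    destruct (main Q hQ) as [e [he [_ hiff]]]. apply hb. exists Q. split; [exact hQ|].
    rewrite <- (proj2 hiff harc). exact he.
Qed.
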